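(* Let $(N,g_N)$ be an $n$-dimensional pseudo-Riemannian manifold, $J\subseteq\mathbb{R}$ an open interval with metric $g_J=\tilde\varepsilon\,\alpha(s)\,ds^2$, where $\tilde\varepsilon\in\{\pm1\}$ and $\alpha:J\to(0,+\infty)$ is smooth, and let $\pi:(N,g_N)\to(J,g_J)$ be a pseudo-Riemannian submersion whose fibres have constant mean curvature, given by the smooth function $h:J\to\mathbb{R}$ (with respect to the normal field $\nabla\pi$). Let $I\subseteq\mathbb{R}$ be an open interval, $b:I\to(0,+\infty)$ smooth, $N\times I$ endowed with $b(t)^2g_N-dt^2$, and $X=b(t)\partial_t$. Let $U\subseteq J$ be open, $f\in C^2(U,I)$, $u=f\circ\pi:\pi^{-1}(U)\to I$, and let $\tilde F(x)=(x,u(x))$ be the graph map of $u$, assumed to induce a non-degenerate metric. Then $\tilde F$ defines an $X$-soliton (respectively, a pointwise $X$-soliton) if, and only if, for all $t$ (respectively, for $t=0$), $$f''=\left(\tilde\varepsilon\alpha-\frac{f'^2}{(b\circ f)^2}\right)\left(hf'+(b\circ f)\left[(b\circ f_t)^2-n\,(b'\circ f_t)\right]\right)+\frac{f'}{2}\left(\log\left(\alpha\,[b\circ f]^2\right)\right)'.$$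
   Context: A pseudo-Riemannian submersion is a surjective submersion whose fibres are pseudo-Riemannian submanifolds and whose differential preserves lengths of horizontal vectors. The function $h$ is determined by $h(\pi(x))=\sum_{i=1}^{n-1}\varepsilon_i\,g_N(\nabla^N_{e_i}e_i,\nabla\pi)(x)$, for any local $g_N$-orthonormal frame $(e_1,\dots,e_{n-1})$ of the vertical distribution with $g_N(e_i,e_j)=\varepsilon_i\delta_{ij}$; constant mean curvature of the fibres means that this depends only on $\pi(x)$. Primes on $f$ and on $\log(\alpha[b\circ f]^2)$ denote $d/ds$; $b'$ is the derivative of $b$. The flow of $X$ is $\Phi_t(x,s)=(x,A(s,t))$ with $A(s,0)=s$ and $\frac{\partial A}{\partial t}(s,t)=b(A(s,t))$. Set $f_t(s)=A(f(s),t)$, $u_t=f_t\circ\pi$ and $\tilde F_t(x)=(x,u_t(x))$, where $t$ ranges over an interval $(-\varepsilon,\varepsilon)$ on which these are defined; ''for all $t$'' means for all $t\in(-\varepsilon,\varepsilon)$. $\tilde F$ is an $X$-soliton if for all $x\in\pi^{-1}(U)$ and all $t\in(-\varepsilon,\varepsilon)$, $b(u_t(x))\,\partial_t^\perp(x,u_t(x))=\vec H_t(x,u_t(x))$, and a pointwise $X$-soliton if this holds for $t=0$. Here $\perp$ is the orthogonal projection to the normal bundle of $\tilde F_t$ and $\vec H_t=\sum_i\varepsilon_i\left(\nabla^{N\times I}_{(\tilde F_t)_*e_i}(\tilde F_t)_*e_i\right)^\perp$ is its mean curvature vector, with $(e_i)$ a local orthonormal frame of signs $\varepsilon_i$ for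 the metric induced by $\tilde F_t$. *)

(* Defs.v *)
From HB Require Import structures.
From mathcomp Require Import all_boot all_order all_algebra.
From mathcomp Require Import all_classical all_reals all_analysis.

Set Implicit Arguments.
Unset Strict Implicit.
Unset Printing Implicit Defensive.

Import Order.TTheory GRing.Theory Num.Theory.
Import numFieldNormedType.Exports.

Local Open Scope classical_set_scope.
Local Open Scope ring_scope.

(* Functions on manifolds, intervals or open sets are represented by total    *)
(* functions; only their values on the set at hand are ever constrained.      *)

(* [Ck k A f]: f is C^k on the open set A. The recursive clause says that f   *)
(* is Frechet differentiable on A and that x |-> df_x is C^(k-1).             *)
Fixpoint Ck (R : realType) (V W : normedModType R) (k : nat) (A : set V)
    (f : V -> W) : Prop :=
  match k with
  | 0 => forall x, A x -> {for x, continuous f}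
  | k'.+1 => (forall x, A x -> differentiable f x) /\
             (forall v : V, Ck k' A (fun x => 'D_v f x))
  end.

Definition smooth (R : realType) (V W : normedModType R) (A : set V)
  (f : V -> W) : Prop := forall k, Ck k A f.

Definition open_interval (R : realType) (J : set R) : Prop :=
  open J /\ is_interval J.

(* Tangent vectors are row vectors, linear maps act on the right, and a       *)
(* bilinear form is given by its Gram matrix.                                 *)
Section LinearAlgebra.
Variable R : realType.

Definition ip m (G : 'M[R]_m) (v w : 'rV[R]_m) : R := (v *m G *m w^T) 0 0.

Definition has_index m (G : 'M[R]_m) (q : nat) : Prop :=
  (q <= m)%N /\
  exists2 P : 'M[R]_m, P \in unitmx &
    P *m G *m P^T = diag_mx (\row_(k < m) (-1) ^+ (k < q)%N).

(* The G-orthogonal projection onto the normal space of a subspace: the rows  *)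
(* of D span the subspace, and [kermx (G *m D^T)] is its orthogonal for G.    *)
Definition normal_proj m k (G : 'M[R]_m) (D : 'M[R]_(k, m)) : 'M[R]_m :=
  proj_mx (kermx (G *m D^T)) <<D>>%MS.

Definition is_sign (e : R) : Prop := e = 1 \/ e = -1.

End LinearAlgebra.

(* Local expressions, in an open subset of R^m carrying the metric            *)
(* p |-> G p.                                                                 *)
Section Coordinates.
Variable R : realType.

Definition christoffel m (G : 'rV[R]_m -> 'M[R]_m) (p : 'rV[R]_m)
    (a b c : 'I_m) : R :=
  let dG (i j k : 'I_m) := 'D_(delta_mx 0 i) (fun q => G q j k) p in
  2^-1 * \sum_d invmx (G p) c d * (dG a d b + dG b a d - dG d a b).

(* Levi-Civita covariant derivative at p, in the direction w, of a vector     *)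
(* field V along a map F : R^k -> R^m. On R^m itself F is the identity.       *)
Definition cov_along k m (G : 'rV[R]_m -> 'M[R]_m) (F V : 'rV[R]_k -> 'rV[R]_m)
    (p w : 'rV[R]_k) : 'rV[R]_m :=
  'D_w V p + \row_c \sum_a \sum_b
    christoffel G (F p) a b c * ('D_w F p) 0 a * (V p) 0 b.

Definition cov m (G : 'rV[R]_m -> 'M[R]_m) (V W : 'rV[R]_m -> 'rV[R]_m)
    (p : 'rV[R]_m) : 'rV[R]_m := cov_along G id W p (V p).

Definition grad m (G : 'rV[R]_m -> 'M[R]_m) (phi : 'rV[R]_m -> R)
    (p : 'rV[R]_m) : 'rV[R]_m :=
  (\row_a 'D_(delta_mx 0 a) phi p) *m invmx (G p).

(* [e] is a field of k vectors orthonormal for the (varying) form B, with     *)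
(* constant signs eps, on the set V.                                          *)
Definition orthonormal_on m k (V : set 'rV[R]_m)
    (B : 'rV[R]_m -> 'rV[R]_m -> 'rV[R]_m -> R)
    (e : 'I_k -> 'rV[R]_m -> 'rV[R]_m) (eps : 'I_k -> R) : Prop :=
  (forall i, is_sign (eps i)) /\
  (forall p, V p -> forall i j, B p (e i p) (e j p) = eps i *+ (i == j)).

Definition induced_form k m (G : 'rV[R]_m -> 'M[R]_m) (F : 'rV[R]_k -> 'rV[R]_m)
    (p v w : 'rV[R]_k) : R := ip (G (F p)) ('D_v F p) ('D_w F p).

(* Projection onto the normal space of F at F p; the rows of the Jacobian     *)
(* span the image of dF.                                                      *)
Definition normal_at k m (G : 'rV[R]_m -> 'M[R]_m) (F : 'rV[R]_k -> 'rV[R]_m)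
    (p : 'rV[R]_k) : 'M[R]_m := normal_proj (G (F p)) ('J F p).

(* [H] is the (unnormalised) mean curvature vector at F p of the immersion    *)
(* F : D -> R^m, computed with any local orthonormal frame. Frames exist      *)
(* around p as soon as the induced metric is non-degenerate; they are C^1,    *)
(* which is the regularity of the metric induced by a C^2 map.                *)
Definition is_mean_curvature k m (G : 'rV[R]_m -> 'M[R]_m) (D : set 'rV[R]_k)
    (F : 'rV[R]_k -> 'rV[R]_m) (p : 'rV[R]_k) (H : 'rV[R]_m) : Prop :=
  forall (V : set 'rV[R]_k) (e : 'I_k -> 'rV[R]_k -> 'rV[R]_k) (eps : 'I_k -> R),
    open V -> V p -> V `<=` D ->
    (forall i, Ck 1 V (e i)) ->
    orthonormal_on V (induced_form G F) e eps ->
    H = \sum_i eps i *: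
          (cov_along G F (fun q => 'D_(e i q) F q) p (e i p) *m normal_at G F p).

End Coordinates.

(* Smooth n-manifolds: [param i] is the inverse of the chart [coord i], whose *)
(* domain is [cdom i].                                                        *)
Record manifold (R : realType) (n : nat) := Manifold {
  carrier :> topologicalType;
  chart : Type;
  cdom : chart -> set carrier;
  coord : chart -> carrier -> 'rV[R]_n;
  param : chart -> 'rV[R]_n -> carrier;
  manifold_hausdorff : hausdorff_space carrier;
  manifold_second_countable : @second_countable carrier;
  cdom_open : forall i, open (cdom i);
  cimg_open : forall i, open (coord i @` cdom i);
  coordK : forall i x, cdom i x -> param i (coord i x) = x;
  coord_continuous : forall i x, cdom i x -> {for x, continuous (coord i)};
  param_continuous : forall i y, (coord i @` cdom i) y ->
    {for y, continuous (param i)};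
  chart_cover : forall x, exists i, cdom i x;
  transition_smooth : forall i j,
    smooth (coord i @` (cdom i `&` cdom j)) (coord j \o param i)
}.

Arguments chart {R n} _.
Arguments cdom {R n m} _ _ : rename.
Arguments coord {R n m} _ _ : rename.
Arguments param {R n m} _ _ : rename.

Definition cimg (R : realType) n (N : manifold R n) (i : chart N) (S : set N) :
  set 'rV[R]_n := coord i @` (cdom i `&` S).

(* A pseudo-Riemannian metric, given by its Gram matrix in each chart, with   *)
(* the transformation law of a (0,2)-tensor and constant index.               *)
Record metric (R : realType) n (N : manifold R n) := Metric {
  gram :> chart N -> 'rV[R]_n -> 'M[R]_n;
  gram_smooth : forall i a b, smooth (cimg i setT) (fun y => gram i y a b);
  gram_sym : forall i y, cimg i setT y -> (gram i y)^T = gram i y;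
  gram_transition : forall i j y, cimg i (cdom j) y ->
    let tau := coord j \o param i in
    gram i y = 'J tau y *m gram j (tau y) *m ('J tau y)^T;
  gram_index : exists q, forall i y, cimg i setT y -> has_index (gram i y) q
}.

Section Submersion.
Variables (R : realType) (n : nat) (N : manifold R n) (g : metric N).

Definition local (T : Type) (phi : N -> T) (i : chart N) : 'rV[R]_n -> T :=
  phi \o param i.

Definition vertical (phi : N -> R) (i : chart N) (y v : 'rV[R]_n) : Prop :=
  'D_v (local phi i) y = 0.

Definition horizontal (phi : N -> R) (i : chart N) (y v : 'rV[R]_n) : Prop :=
  forall w, vertical phi i y w -> ip (g i y) v w = 0.

(* Pseudo-Riemannian submersions onto J with the metric te * alpha(s) ds^2.   *)
Definition pr_submersion (J : set R) (te : R) (alpha : R -> R) (phi : N -> R) :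
    Prop :=
  [/\ range phi = J,
      forall i, smooth (cimg i setT) (local phi i),
      forall i y, cimg i setT y -> exists v, 'D_v (local phi i) y != 0,
      forall i y, cimg i setT y -> forall v,
        vertical phi i y v -> horizontal phi i y v -> v = 0
    & forall i y, cimg i setT y -> forall v, horizontal phi i y v ->
        ip (g i y) v v =
          te * alpha (local phi i y) * ('D_v (local phi i) y) ^+ 2 ].

(* The fibres of phi have constant mean curvature, given by the function h,   *)
(* with respect to the normal field grad phi.                                 *)
Definition fibres_cmc (phi : N -> R) (h : R -> R) : Prop :=
  forall (i : chart N) (V : set 'rV[R]_n) (y : 'rV[R]_n)
    (e : 'I_n.-1 -> 'rV[R]_n -> 'rV[R]_n) (eps : 'I_n.-1 -> R),
    open V -> V y -> V `<=` cimg i setT ->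
    (forall a, smooth V (e a)) ->
    (forall p, V p -> forall a, vertical phi i p (e a p)) ->
    orthonormal_on V (fun p => ip (g i p)) e eps ->
    h (local phi i y) =
      \sum_a eps a * ip (g i y) (cov (g i) (e a) (e a) y)
                                (grad (g i) (local phi i) y).

End Submersion.

Section Solitons.
Variables (R : realType) (n : nat) (N : manifold R n) (g : metric N).
Variable b : R -> R.

(* The metric b(t)^2 g - dt^2 of N x I in the product chart (chart i, t);     *)
(* t is the last coordinate.                                                  *)
Definition warped (i : chart N) (p : 'rV[R]_(n + 1)) : 'M[R]_(n + 1) :=
  block_mx (b (rsubmx p 0 0) ^+ 2 *: g i (lsubmx p)) 0 0 (-1)%:M.

Definition partial_t : 'rV[R]_(n + 1) := row_mx 0 1%:M.

Definition graph (v : N -> R) (i : chart N) (y : 'rV[R]_n) : 'rV[R]_(n + 1) :=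
  row_mx y (local v i y)%:M.

Definition graph_nondegenerate (S : set N) (v : N -> R) : Prop :=
  forall i y, cimg i S y -> forall w,
    (forall z, induced_form (warped i) (graph v i) y w z = 0) -> w = 0.

(* X^perp = H along the graph over S of v, where X = b(t) d/dt.               *)
Definition soliton_eq (S : set N) (v : N -> R) : Prop :=
  forall i y, cimg i S y ->
    is_mean_curvature (warped i) (cimg i S) (graph v i) y
      (b (local v i y) *: (partial_t *m normal_at (warped i) (graph v i) y)).

(* The trajectories of X issued from the points of S stay in I for            *)
(* |t| < epsilon, and are given there by A.                                   *)
Definition is_flow (I S : set R) (epsilon : R) (A : R -> R -> R) : Prop :=
  forall s, S s -> forall t, `|t| < epsilon ->
    I (A s t) /\ is_derive t 1 (A s) (b (A s t)).

Definition flowed (A : R -> R -> R) (f : R -> R) (t : R) : R -> R :=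
  fun s => A (f s) t.

Definition X_soliton (phi : N -> R) (U : set R) (f : R -> R) (A : R -> R -> R)
    (epsilon : R) : Prop :=
  forall t, `|t| < epsilon -> soliton_eq (phi @^-1` U) (flowed A f t \o phi).

Definition pointwise_X_soliton (phi : N -> R) (U : set R) (f : R -> R)
    (A : R -> R -> R) : Prop :=
  soliton_eq (phi @^-1` U) (flowed A f 0 \o phi).

End Solitons.

Definition soliton_ode (R : realType) (n : nat) (te : R) (alpha h b : R -> R)
    (U : set R) (f ft : R -> R) : Prop :=
  forall s, U s ->
    let f' := derive1 f s in
    derive1n 2 f s =
      (te * alpha s - f' ^+ 2 / b (f s) ^+ 2) *
        (h s * f' + b (f s) * (b (ft s) ^+ 2 - n%:R * derive1 b (ft s)))
      + f' / 2 * derive1 (fun r => ln (alpha r * b (f r) ^+ 2)) s.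

(* Main.v *)
(** Write psi for the submersion in a chart, v = ft o psi, b for b(v), and let
    gamma = b^2 g - dv^2 be the metric induced on the graph of v.  The covector
    (-dv, 1) annihilates the tangent space of the graph, and pairing it with
    X^perp - H turns the soliton equation into

      b = tr_gamma (Hess_g v + b b' g - 2 (b'/b) dv^2).

    This trace is computed in the gamma-orthogonal basis formed by a
    g-orthonormal frame of the vertical space and grad psi.  The sum of Hess psi
    over the vertical frame is - h, and differentiating
    |grad psi|^2 = te / alpha(psi) along grad psi gives
    Hess psi (grad psi, grad psi) = - alpha' / (2 alpha^3).  Since the flow of
    b d/dt is the translation flow of the time coordinate \int dt / b, the
    function rho = ft' / b(ft) does not depend on t, and the trace identity
    becomes

      rho' = (te alpha - rho^2) (rho h + b^2 - n b') + rho alpha' / (2 alpha),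

    which is the equation of the theorem written in terms of rho = f' / b(f).
    The mean curvatures are hypotheses over all local orthonormal frames, so
    such frames have to be constructed: this is the Gram-Schmidt argument of
    [local_diagonalization]. *)

Require Import Defs.
From HB Require Import structures.
From mathcomp Require Import all_boot all_order all_algebra.
From mathcomp Require Import all_classical all_reals all_analysis.
From mathcomp Require Import ring lra.

Set Implicit Arguments.
Unset Strict Implicit.
Unset Printing Implicit Defensive.

Import Order.TTheory GRing.Theory Num.Theory.
Import numFieldNormedType.Exports.

Local Open Scope classical_set_scope.
Local Open Scope ring_scope.

(** * Functions of class C^k *)

Section Calculus.
Variable R : realType.

(** The difference [g - f] vanishes near [x], hence is differentiable there with differential 0, and
    [g] is the sum of [f] and this difference. *)
Lemma near_eq_differentiable (V W : normedModType R) (f g : V -> W) (x : V) :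
  (\near x, f x = g x) -> differentiable f x -> differentiable g x.
Proof.
move=> fg df.
have -> : g = f + (g - f) by rewrite addrC subrK.
apply: differentiableD => //.
set d := g - f.
have d0 : \near x, d x = 0.
  by apply: filterS fg => y fgy; apply/eqP; rewrite subr_eq0 -fgy.
have dx : d x = 0 by apply: nbhs_singleton d0.
(* A first-order expansion with zero linear part; by uniqueness of such an expansion it identifies
   the differential of [d] at [x]. *)
have key : d \o shift x = cst (d x) + \0 +o_ 0 id.
  apply/eqaddoP => e e0.
  have d0' : \forall h \near (0 : V), d (h + x) = 0.
    by move: d0; rewrite (near_shift 0 x) /=; apply: filterS => h; rewrite /= subr0.
  near=> h.
  have hd : d (h + x) = 0 by near: h.
  change (`|d (h + x) - (d x + 0)| <= e * `|h|).
  by rewrite hd dx addr0 subr0 normr0 mulr_ge0// ltW.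
apply/diff_locallyP; rewrite (diff_unique _ key); last exact: cst_continuous.
split; first exact: cst_continuous.
exact: key.
Unshelve. all: by end_near. Qed.

Section Open.
Variables (V : normedModType R) (A : set V).
Hypothesis oA : open A.

Lemma open_near_eq (W : Type) (f g : V -> W) (x : V) :
  A x -> (forall y, A y -> f y = g y) -> \near x, f x = g x.
Proof.
by move=> Ax fg; near=> y; apply: fg; near: y; apply: open_nbhs_nbhs.
Unshelve. all: by end_near. Qed.

Lemma Ck_ext (W : normedModType R) (k : nat) (f g : V -> W) :
  (forall y, A y -> f y = g y) -> Ck k A f -> Ck k A g.
Proof.
elim: k f g => [|k IH] f g fg /=.
  move=> cf x Ax; have nfg := open_near_eq Ax fg.
  change (g @ x --> g x); rewrite -(fg _ Ax); apply: cvg_trans (cf x Ax).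
  exact: near_eq_cvg.
move=> [df Df]; split.
  by move=> x Ax; apply: near_eq_differentiable (df x Ax); apply: open_near_eq.
move=> v; apply: IH (Df v) => y Ay.
by apply: near_eq_derive; apply: open_near_eq.
Qed.

Lemma Ck_continuous (W : normedModType R) (k : nat) (f : V -> W) (x : V) :
  Ck k A f -> A x -> {for x, continuous f}.
Proof.
case: k => [|k] cf Ax; first exact: cf.
by apply: differentiable_continuous; exact: cf.1.
Qed.

Lemma Ck_pred (W : normedModType R) (k : nat) (f : V -> W) :
  Ck k.+1 A f -> Ck k A f.
Proof.
elim: k f => [|k IH] f cf.
  by move=> x Ax; apply: Ck_continuous cf Ax.
by split; [exact: cf.1 | move=> v; apply: IH; exact: cf.2].
Qed.

Lemma Ck_cst (W : normedModType R) (k : nat) (w : W) : Ck k A (fun=> w).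
Proof.
elim: k w => [|k IH] w; first by move=> x _; exact: cst_continuous.
split=> [x _|v]; first exact: differentiable_cst.
by apply: Ck_ext (IH 0) => y _; rewrite derive_cst.
Qed.

Lemma CkD (W : normedModType R) (k : nat) (f g : V -> W) :
  Ck k A f -> Ck k A g -> Ck k A (fun x => f x + g x).
Proof.
elim: k f g => [|k IH] f g cf cg.
  by move=> x Ax; apply: continuousD; [exact: cf|exact: cg].
split=> [x Ax|v]; first by apply: differentiableD; [exact: cf.1|exact: cg.1].
apply: Ck_ext (IH _ _ (cf.2 v) (cg.2 v)) => y Ay; rewrite -deriveD //.
- by apply: diff_derivable; exact: cf.1.
- by apply: diff_derivable; exact: cg.1.
Qed.

Lemma Ck_sum (W : normedModType R) (k : nat) (I : Type) (r : seq I)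
    (P : pred I) (f : I -> V -> W) :
  (forall i, P i -> Ck k A (f i)) -> Ck k A (fun x => \sum_(i <- r | P i) f i x).
Proof.
move=> cf; elim: r => [|i r IH].
  by apply: Ck_ext (Ck_cst k 0) => y _; rewrite big_nil.
have [Pi|nPi] := boolP (P i).
  apply: Ck_ext (CkD (cf i Pi) IH) => y _.
  by rewrite [RHS]big_cons Pi.
by apply: Ck_ext IH => y _; rewrite [RHS]big_cons (negbTE nPi).
Qed.

Lemma CkM (k : nat) (f g : V -> R) :
  Ck k A f -> Ck k A g -> Ck k A (fun x => f x * g x).
Proof.
elim: k f g => [|k IH] f g cf cg.
  by move=> x Ax; apply: continuousM; [exact: cf|exact: cg].
split=> [x Ax|v]; first by apply: differentiableM; [exact: cf.1|exact: cg.1].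
apply: Ck_ext (CkD (IH _ _ (Ck_pred cf) (cg.2 v)) (IH _ _ (Ck_pred cg) (cf.2 v))).
move=> y Ay; rewrite deriveM //.
- by apply: diff_derivable; exact: cf.1.
- by apply: diff_derivable; exact: cg.1.
Qed.

Lemma CkZl (W : normedModType R) (k : nat) (f : V -> R) (w : W) :
  Ck k A f -> Ck k A (fun x => f x *: w).
Proof.
elim: k f => [|k IH] f cf.
  by move=> x Ax; apply: continuousZl; exact: cf.
split=> [x Ax|v]; first by apply: differentiableZl; exact: cf.1.
apply: Ck_ext (IH _ (cf.2 v)) => y Ay; rewrite !deriveE ?diffZl //; try exact: cf.1.
by apply: differentiableZl; exact: cf.1.
Qed.

Lemma derive_compr (f : V -> R) (F : R -> R) (x v : V) :
  differentiable f x -> differentiable F (f x) ->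
  'D_v (F \o f) x = 'D_1 F (f x) * 'D_v f x.
Proof.
move=> df dF; rewrite deriveE; last exact: differentiable_comp.
rewrite diff_comp // [X in _ = _ * X]deriveE //= deriveE //.
by rewrite -{1}[X in 'd F _ X]mulr1 linearZ mulrC.
Qed.

(* Covers both the inverse (c = -1, m = 2) and its square root
   (c = -1/2, m = 3). *)
Lemma Ck_comp_autonomous (k : nat) (f : V -> R) (F : R -> R) (O : set R)
    (c : R) (m : nat) :
  (forall x, O x -> is_derive x 1 F (c * F x ^+ m)) ->
  (forall x, A x -> O (f x)) -> Ck k A f -> Ck k A (F \o f).
Proof.
move=> dF fO.
have dFf x : A x -> differentiable F (f x).
  move=> Ax; apply/derivable1_diffP.
  by have [] := dF _ (fO _ Ax).
elim: k f fO dFf => [|k IH] f fO dFf cf.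
  move=> x Ax; apply: continuous_comp; first exact: cf.
  by apply: differentiable_continuous; exact: dFf.
split=> [x Ax|v].
  by apply: differentiable_comp; [exact: cf.1|exact: dFf].
(* The derivative of [F \o f] is [c (F \o f)^m df], again built from [F \o f]: regularity of the
   composite at order [k] yields order [k+1]. *)
have cFf := IH _ fO dFf (Ck_pred cf).
have cX : Ck k A (fun x => (F \o f) x ^+ m).
  elim: m {dF IH dFf fO cf} => [|m IHm]; first exact: (Ck_cst k (1 : R)).
  by apply: Ck_ext (CkM cFf IHm) => y _; rewrite exprS.
apply: Ck_ext (CkM (CkM (Ck_cst k c) cX) (cf.2 v)) => y Ay.
rewrite derive_compr; [|exact: cf.1|exact: dFf].
by have [_ ->] := dF _ (fO _ Ay).
Qed.

Lemma CkV (k : nat) (f : V -> R) :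
  (forall x, A x -> f x != 0) -> Ck k A f -> Ck k A (fun x => (f x)^-1).
Proof.
move=> f0; apply: (@Ck_comp_autonomous k f GRing.inv [set x | x != 0] (-1) 2) => //.
move=> x /= x0; apply: is_derive_eq.
  exact: (@is_deriveV R id x 1 1).
by rewrite /GRing.scale /= mulr1 mulN1r exprVn.
Qed.

Lemma Ck_invsqrt (k : nat) (f : V -> R) :
  (forall x, A x -> 0 < f x) -> Ck k A f ->
  Ck k A (fun x => (Num.sqrt (f x))^-1).
Proof.
move=> f0; apply: (@Ck_comp_autonomous k f (fun x => (Num.sqrt x)^-1)
  [set x | 0 < x] (- 2^-1) 3) => //.
move=> x /= x0; have sx0 : Num.sqrt x != 0 by rewrite gt_eqF // sqrtr_gt0.
have dsx := is_derive1_sqrt x0.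
apply: is_derive_eq.
rewrite /GRing.scale /=; field.
by rewrite sx0.
Qed.

End Open.

End Calculus.

(** * The flow of b d/dt *)

Section Flow.
Variable R : realType.
Local Notation mu := (@lebesgue_measure R).

(** Supplies a segment inside [I] having both points in its interior, on which a continuous
    integrand can be handled by the fundamental theorem of calculus. *)
Lemma open_interval_bounds (I : set R) (x c : R) :
  open_interval I -> I x -> I c ->
  exists a u, [/\ a < x, a < c, x < u, c < u & `[a, u] `<=` I].
Proof.
move=> [oI iI].
have ends y : I y -> exists2 e, 0 < e & I (y - e) /\ I (y + e).
  move=> Iy; have /nbhs_ballP[e /= e0 eI] : nbhs y I by exact: open_nbhs_nbhs.
  exists (e / 2); first by rewrite divr_gt0.
  by split; apply: eI; rewrite /ball /= ?opprD ?opprB ?addrA ?subrr ?add0r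
    ?[y - (y - _)]opprB ?subKr ?normrN gtr0_norm ?divr_gt0// ltr_pdivrMr// ltr_pMr// ltr1n.
wlog xc : x c / x <= c.
  move=> W Ix Ic; have [|/ltW] := leP x c; first by move=> xc; apply: W.
  move=> cx; have [a [u [? ? ? ? ?]]] := W _ _ cx Ic Ix.
  by exists a, u; split.
move=> /ends[d d0 [Ixd _]] /ends[e e0 [_ Ice]].
exists (x - d), (c + e); split; try lra.
move=> z /= /[!in_itv] /= /andP[xz zc].
by apply: iI Ixd Ice _ _; rewrite xz zc.
Qed.

Lemma primitive_on (I : set R) (k : R -> R) : open_interval I ->
  (forall x, I x -> {for x, continuous k}) ->
  exists T : R -> R, forall x, I x -> is_derive x 1 T (k x).
Proof.
move=> hI ck.
have [->|/set0P[c Ic]] := eqVneq I set0; first by exists (fun=> 0) => x [].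
(* The oriented integral from [c] to [y]: whichever of the two integrals runs over a reversed
   interval is zero, its domain being empty or a point. *)
exists (fun y => \int[mu]_(z in `[c, y]) k z - \int[mu]_(z in `[y, c]) k z).
move=> x Ix; have [a [u [ax ac xu cu auI]]] := open_interval_bounds hI Ix Ic.
have int y : y <= u -> mu.-integrable `[a, y] (EFin \o k).
  move=> yu; apply: continuous_compact_integrable; first exact: segment_compact.
  apply: continuous_in_subspaceT => z /[!inE] /= zay; apply: ck; apply: auI.
  move: zay; rewrite /= !in_itv /= => /andP[-> zy] /=; exact: le_trans yu.
have [dF F'] := continuous_FTC1_closed xu (int _ (lexx u)) ax (ck _ Ix).
have FD : is_derive x 1 (fun y => \int[mu]_(z in `[a, y]) k z) (k x).
  by apply: DeriveDef => //; rewrite -derive1E.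
(* Subtracting the constant integral over [[a, c]] moves the base point from [a] to [c] without
   changing the derivative. *)
have {}FD := is_deriveB FD (is_derive_cst (\int[mu]_(z in `[a, c]) k z) x 1).
rewrite subr0 in FD; apply: near_eq_is_derive FD; near=> y.
have ay : a < y by near: y; apply: lt_nbhsr.
have yu : y < u by near: y; apply: lt_nbhsl.
change (\int[mu]_(z in `[a, y]) k z - \int[mu]_(z in `[a, c]) k z =
  \int[mu]_(z in `[c, y]) k z - \int[mu]_(z in `[y, c]) k z).
have [cy|yc] := leP c y.
- have -> : \int[mu]_(z in `[y, c]) k z = 0.
    have [yc|yc] := eqVneq y c; first by rewrite yc set_itv1 Rintegral_set1.
    by rewrite set_itv_ge ?Rintegral_set0// bnd_simp -ltNge lt_neqAle eq_sym yc.
  rewrite subr0 -[RHS]Rintegral_itv_obnd_cbnd.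
    by rewrite -(Rintegral_itvB (int _ (ltW yu))) ?bnd_simp // ltW.
  apply: integrableS (int _ (ltW yu)) => //.
  by apply: subset_itv; rewrite bnd_simp // ltW.
- have -> : \int[mu]_(z in `[c, y]) k z = 0.
    by rewrite set_itv_ge ?Rintegral_set0// bnd_simp -ltNge.
  rewrite sub0r -[LHS]opprB; congr (- _).
  rewrite -[RHS]Rintegral_itv_obnd_cbnd.
    by rewrite -(Rintegral_itvB (int _ (ltW cu))) ?bnd_simp // ltW.
  apply: integrableS (int _ (ltW cu)) => //.
  by apply: subset_itv; rewrite bnd_simp // ltW.
Unshelve. all: by end_near. Qed.

Lemma is_derive_MVT (f df : R -> R) (a b : R) : a < b ->
  (forall x, x \in `[a, b] -> is_derive x 1 f (df x)) ->
  exists2 c, c \in `[a, b] & f b - f a = df c * (b - a).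
Proof.
move=> ab fdf.
have fdfo x : x \in `]a, b[ -> is_derive x 1 f (df x).
  by move=> xab; apply: fdf; exact: subset_itv_oo_cc xab.
have cf : {within `[a, b], continuous f}.
  by apply: derivable_within_continuous => x /fdf[].
have [c cab ->] := MVT ab fdfo cf.
by exists c => //; exact: subset_itv_oo_cc cab.
Qed.

(** * Flow lines in the time coordinate *)

Section FlowOfField.
Variables (I S : set R) (b : R -> R) (epsilon : R) (A : R -> R -> R).
Hypotheses (hI : open_interval I) (hb : smooth I b) (hb0 : forall t, I t -> 0 < b t).
Hypotheses (hA0 : forall s, I s -> A s 0 = s) (hA : is_flow b I S epsilon A).

(* In the coordinate T, an antiderivative of 1/b, the flow is a translation. *)
Lemma flow_translation : exists T,
  [/\ forall x, I x -> is_derive x 1 T (b x)^-1,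
      forall x y, I x -> I y -> T x = T y -> x = y
    & forall x t, S x -> I x -> `|t| < epsilon -> T (A x t) = T x + t].
Proof.
have ck x : I x -> {for x, continuous (fun x => (b x)^-1)}.
  move=> Ix; apply: continuousV; first by rewrite gt_eqF// hb0.
  exact: Ck_continuous (hb 0) Ix.
have [T dT] := primitive_on hI ck; exists T; split => //.
- have mono x y : I x -> I y -> x < y -> T x < T y.
    move=> Ix Iy xy; have dTxy z : z \in `[x, y] -> is_derive z 1 T (b z)^-1.
      by move=> zxy; apply: dT; apply: hI.2 Ix Iy _ _; rewrite in_itv in zxy.
    have [c cxy E] := is_derive_MVT xy dTxy.
    rewrite -subr_gt0 E mulr_gt0 ?subr_gt0// invr_gt0 hb0//.
    by apply: hI.2 Ix Iy _ _; rewrite in_itv in cxy.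
  move=> x y Ix Iy Txy; case: (ltgtP x y) => // /mono.
    by move=> /(_ Ix Iy); rewrite Txy ltxx.
  by move=> /(_ Iy Ix); rewrite Txy ltxx.
- move=> x t Sx Ix te.
  (* Along a trajectory [T] grows at rate [b / b = 1], so [D] has derivative 0 on the interval of
     times and the mean value theorem makes it constant. *)
  pose D u := T (A x u) - u.
  have dD (u : R) : `|u| < epsilon -> is_derive u 1 D 0.
    move=> ue; have [IA dA] := hA Sx ue.
    have := is_deriveB (is_derive1_comp (dT _ IA) dA) (is_derive_id u 1).
    by rewrite mulVf ?subrr// gt_eqF// hb0.
  suff : D t = D 0 by rewrite /D subr0 hA0// => <-; rewrite subrK.
  have nle u v w : u <= v <= w -> `|u| < epsilon -> `|w| < epsilon -> `|v| < epsilon.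
    by rewrite !ltr_norml => /andP[uv vw] /andP[u1 u2] /andP[w1 w2]; apply/andP; split; lra.
  have e0 : `|0 : R| < epsilon by rewrite normr0; exact: le_lt_trans (normr_ge0 t) te.
  case: (ltgtP t 0) => [t0|t0|->//].
  + have dDt z : z \in `[t, 0] -> is_derive z 1 D 0.
      by move=> /[!in_itv] /= zt; apply: dD; exact: nle zt te e0.
    have [z _] := is_derive_MVT t0 dDt.
    by rewrite mul0r => /esym/eqP; rewrite eq_sym subr_eq0 eq_sym => /eqP.
  + have dDt z : z \in `[0, t] -> is_derive z 1 D 0.
      by move=> /[!in_itv] /= zt; apply: dD; exact: nle zt e0 te.
    have [z _] := is_derive_MVT t0 dDt.
    by rewrite mul0r => /eqP; rewrite subr_eq0 => /eqP.
Qed.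

(** The flow is given as differentiable in time only. Its dependence on the initial point is
    recovered from [flowed A f t = T^-1 (T \o f + t)], by the derivative of an inverse function and
    the chain rule. *)
Lemma flow_derive (U : set R) (f : R -> R) (s t df : R) :
  open U -> f @` U `<=` S -> f @` U `<=` I -> U s -> `|t| < epsilon ->
  is_derive s 1 f df ->
  is_derive s 1 (flowed A f t) (b (A (f s) t) * (df / b (f s))).
Proof.
move=> oU fS fI Us te dfs.
have [T [dT Tinj TA]] := flow_translation.
(* Inverse of [T] on its image, by choice; 0 is the default value off the image. *)
pose Ti z := xget 0 [set x | I x /\ T x = z].
have TiK x : I x -> Ti (T x) = x.
  move=> Ix; rewrite /Ti; apply: xget_unique => // y [Iy Txy].
  exact: Tinj.
have Sf r : U r -> S (f r) by move=> Ur; apply: fS; exists r.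
have If r : U r -> I (f r) by move=> Ur; apply: fI; exists r.
have IA := (hA (Sf _ Us) te).1.
have nI : nbhs (A (f s) t) I by apply: open_nbhs_nbhs; split => //; exact: hI.1.
have b0 : (b (A (f s) t))^-1 != 0 by rewrite invr_eq0 gt_eqF// hb0.
have nK : {near A (f s) t, cancel T Ti} by apply: filterS nI => x; exact: TiK.
have nC : {near A (f s) t, continuous T}.
  apply: filterS nI => x /dT[+ _] => /derivable1_diffP.
  exact: differentiable_continuous.
have := is_derive_inverse nK nC (dT _ IA) b0.
rewrite invrK TA //; [move=> dTi|exact: Sf|exact: If].
have dG : is_derive s 1 (fun r => T (f r) + t) (df / b (f s)).
  have := is_deriveD (is_derive1_comp (dT _ (If _ Us)) dfs) (is_derive_cst t s 1).
  by rewrite addr0 mulrC.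
have E : \near s, (Ti \o (fun r => T (f r) + t)) s = flowed A f t s.
  apply: (open_near_eq oU Us) => r Ur /=.
  by rewrite -TA ?TiK//; [exact: (hA (Sf _ Ur) te).1|exact: Sf|exact: If].
exact: (near_eq_is_derive E (@is_derive1_comp R Ti (fun r => T (f r) + t) s _ _ dTi dG)).
Qed.

End FlowOfField.
End Flow.

(** * Local orthonormal frames *)

Section Frames.
Variable R : realType.

Lemma ip_tr m (G : 'M[R]_m) (v w : 'rV[R]_m) : ip G^T v w = ip G w v.
Proof.
by rewrite /ip -[RHS]trace_mx11 -mxtrace_tr trace_mx11 !trmx_mul trmxK mulmxA.
Qed.

Lemma ipDl m (G : 'M[R]_m) (u v w : 'rV[R]_m) : ip G (u + v) w = ip G u w + ip G v w.
Proof. by rewrite /ip !mulmxDl mxE. Qed.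

Lemma ipDr m (G : 'M[R]_m) (u v w : 'rV[R]_m) : ip G u (v + w) = ip G u v + ip G u w.
Proof. by rewrite /ip linearD mulmxDr mxE. Qed.

Lemma ipZl m (G : 'M[R]_m) c (v w : 'rV[R]_m) : ip G (c *: v) w = c * ip G v w.
Proof. by rewrite /ip -!scalemxAl mxE. Qed.

Lemma ipZr m (G : 'M[R]_m) c (v w : 'rV[R]_m) : ip G v (c *: w) = c * ip G v w.
Proof. by rewrite /ip linearZ -scalemxAr mxE. Qed.

Lemma ip_delta m (G : 'M[R]_m) i j : ip G (delta_mx 0 i) (delta_mx 0 j) = G i j.
Proof. by rewrite /ip trmx_delta -rowE -colE !mxE. Qed.

Lemma ipE m (G : 'M[R]_m) (v w : 'rV[R]_m) :
  ip G v w = \sum_a \sum_b G a b * v 0 a * w 0 b.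
Proof.
rewrite /ip mxE exchange_big /=; apply: eq_bigr => b _.
rewrite !mxE mulr_suml; apply: eq_bigr => a _.
by rewrite [v 0 a * _]mulrC.
Qed.

Lemma ip_row r m (X : 'M[R]_(r, m)) (G : 'M[R]_m) i j :
  ip G (row i X) (row j X) = (X *m G *m X^T) i j.
Proof. by rewrite /ip -row_mul !mxE; apply: eq_bigr => k _; rewrite !mxE. Qed.

(** If [P] has the vectors [x i] as rows, then [P G P^T] is the diagonal matrix of the [d i], so
    [invmx G = P^T D P] with [D] the inverse diagonal, and the trace is cyclic. *)
Lemma trace_frame m (G M : 'M[R]_m) (x : 'I_m -> 'rV[R]_m) (d : 'I_m -> R) :
  (forall i, d i != 0) ->
  (forall i j, ip G (x i) (x j) = d i *+ (i == j)) ->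
  \sum_i (d i)^-1 * ip M (x i) (x i) = \tr (invmx G *m M).
Proof.
move=> d0 xd.
pose P := \matrix_i x i; pose D := diag_mx (\row_i (d i)^-1).
have PGP : P *m G *m P^T = diag_mx (\row_i d i).
  by apply/matrixP => i j; rewrite -ip_row !rowK xd !mxE.
have : P *m (G *m P^T *m D) = 1%:M.
  rewrite !mulmxA PGP mulmx_diag; apply/matrixP => i j.
  by rewrite !mxE divff // d0.
move=> /mulmx1C; rewrite -!mulmxA => GK.
have [uG _] := mulmx1_unit GK.
have -> : invmx G = P^T *m (D *m P) by rewrite -[RHS](mulKmx uG) GK mulmx1.
rewrite -mulmxA mxtrace_mulC -!mulmxA /mxtrace; apply: eq_bigr => i _.
by rewrite mul_diag_mx mulmxA mxE -ip_row !rowK mxE.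
Qed.

(** By polarization a symmetric form without non-isotropic vector is zero, hence singular. A
    non-isotropic vector, up to a scalar, is then made the first row of an invertible matrix. *)
Lemma pivot m (S : 'M[R]_m.+1) : S^T = S -> S \in unitmx ->
  exists2 C : 'M[R]_m.+1, C \in unitmx & (C *m S *m C^T) 0 0 != 0.
Proof.
move=> symS uS.
have [v v0] : exists v, ip S v v != 0.
  apply: contrapT => /forallNP S0.
  have {}S0 v : ip S v v = 0 by apply/eqP/negPn/negP; exact: S0.
  have Sij i j : S i j = 0.
    have := S0 (delta_mx 0 i + delta_mx 0 j).
    rewrite ipDl !ipDr !S0 !ip_delta add0r addr0 -{2}symS mxE -mulr2n.
    by move/eqP; rewrite mulrn_eq0 => /eqP.
  move: uS; have -> : S = 0 by apply/matrixP => i j; rewrite mxE.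
  by rewrite unitmxE det0 unitr0.
exists (row_ebase v); first exact: row_ebase_unit.
rewrite -ip_row; apply: contraNneq v0 => e0.
(* In the rank factorization of a row vector, only the first row of [row_ebase v] contributes. *)
have [c ->] : exists c, v = c *: row 0 (row_ebase v).
  have [r0|r0] := eqVneq (\rank v) 0%N.
    by exists 0; rewrite scale0r; apply/eqP; rewrite -mxrank_eq0 r0.
  have r1 : \rank v = 1%N by apply/eqP; rewrite eqn_leq rank_leq_row lt0n.
  exists (col_ebase v 0 0).
  rewrite -{1}[v]mulmx_ebase {1}[col_ebase v]mx11_scalar mul_scalar_mx -scalemxAl r1.
  congr (_ *: _); rewrite rowE; congr (_ *m _); apply/rowP => j.
  by rewrite !mxE /= andbT eq_sym.
by rewrite ipZl ipZr e0 !mulr0.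
Qed.

(** * Matrix-valued functions of class C^k *)

Section CkMatrix.
Variables (V : normedModType R) (K : nat -> Prop).

Lemma Ck_subset (W : normedModType R) k (A B : set V) (f : V -> W) :
  B `<=` A -> Ck k A f -> Ck k B f.
Proof.
move=> BA; elim: k f => [|k IH] f cf; first by move=> x /BA; exact: cf.
by split=> [x /BA|v]; [exact: cf.1|exact: IH (cf.2 v)].
Qed.

(** [K] is the set of orders of differentiability carried along: [K = {1}] produces the C^1 frames
    of the induced metric, [K] everything the smooth vertical frames, from one construction. *)
Definition Ck_mx (A : set V) m n (M : V -> 'M[R]_(m, n)) :=
  forall k, K k -> forall i j, Ck k A (fun q => M q i j).

Lemma Ck_mx_subset (A B : set V) m n (M : V -> 'M[R]_(m, n)) :
  B `<=` A -> Ck_mx A M -> Ck_mx B M.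
Proof. by move=> BA cM k Kk i j; apply: Ck_subset BA (cM k Kk i j). Qed.

Variable A : set V.
Hypothesis oA : open A.

Lemma Ck_mx_cst m n (C : 'M[R]_(m, n)) : Ck_mx A (fun=> C).
Proof. by move=> k Kk i j; exact: Ck_cst. Qed.

Lemma Ck_mx_tr m n (M : V -> 'M[R]_(m, n)) : Ck_mx A M -> Ck_mx A (fun q => (M q)^T).
Proof.
by move=> cM k Kk i j; apply: Ck_ext (cM k Kk j i) => // q _; rewrite mxE.
Qed.

Lemma Ck_mx_mul m n p (M : V -> 'M[R]_(m, n)) (N : V -> 'M[R]_(n, p)) :
  Ck_mx A M -> Ck_mx A N -> Ck_mx A (fun q => M q *m N q).
Proof.
move=> cM cN k Kk i j.
apply: (@Ck_ext _ _ _ oA _ k (fun q => \sum_l M q i l * N q l j)).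
  by move=> q _; rewrite mxE.
by apply: Ck_sum => // l _; apply: CkM => //; [exact: cM|exact: cN].
Qed.

Lemma Ck_mx_scale m n (f : V -> R) (M : V -> 'M[R]_(m, n)) :
  (forall k, K k -> Ck k A f) -> Ck_mx A M -> Ck_mx A (fun q => f q *: M q).
Proof.
move=> cf cM k Kk i j.
apply: (@Ck_ext _ _ _ oA _ k (fun q => f q * M q i j)) => [q _|]; first by rewrite mxE.
by apply: CkM => //; [exact: cf|exact: cM].
Qed.

Lemma Ck_mx_block m1 m2 n1 n2 (Aul : V -> 'M[R]_(m1, n1)) (Aur : V -> 'M[R]_(m1, n2))
    (Adl : V -> 'M[R]_(m2, n1)) (Adr : V -> 'M[R]_(m2, n2)) :
  Ck_mx A Aul -> Ck_mx A Aur -> Ck_mx A Adl -> Ck_mx A Adr ->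
  Ck_mx A (fun q => block_mx (Aul q) (Aur q) (Adl q) (Adr q)).
Proof.
move=> c1 c2 c3 c4 k Kk i j.
case: (split_ordP i) => i' ->; case: (split_ordP j) => j' ->.
- by apply: Ck_ext (c1 k Kk i' j') => // q _; rewrite block_mxEul.
- by apply: Ck_ext (c2 k Kk i' j') => // q _; rewrite block_mxEur.
- by apply: Ck_ext (c3 k Kk i' j') => // q _; rewrite block_mxEdl.
- by apply: Ck_ext (c4 k Kk i' j') => // q _; rewrite block_mxEdr.
Qed.

Lemma Ck_mx_row n (M : V -> 'rV[R]_n) k : Ck_mx A M -> K k -> Ck k A M.
Proof.
move=> cM Kk.
apply: (@Ck_ext _ _ _ oA _ k (fun q => \sum_j M q 0 j *: delta_mx 0 j)).
  by move=> q _; rewrite [RHS]row_sum_delta.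
by apply: Ck_sum => // j _; apply: CkZl => //; exact: cM.
Qed.

End CkMatrix.

(* Gram-Schmidt with a constant change of basis making the pivot non-null. *)
Lemma local_diagonalization (V : normedModType R) (K : nat -> Prop) (k0 : nat)
    m (A : set V) (p : V) (S : V -> 'M[R]_m) :
  K k0 -> open A -> A p -> Ck_mx K A S -> (forall q, A q -> (S q)^T = S q) ->
  S p \in unitmx ->
  exists (B : set V) (d : 'rV[R]_m) (P : V -> 'M[R]_m),
    [/\ open B, B p, B `<=` A, forall i, is_sign (d 0 i)
      & Ck_mx K B P /\ forall q, B q -> P q *m S q *m (P q)^T = diag_mx d].
Proof.
move=> Kk0; elim: m A S => [|m IH] A S oA Ap cS symS uS.
  exists A, 0, (fun=> 0); split => //; first by case.
  by split=> [k Kk [] //|q Aq]; apply/matrixP => -[].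
have [C uC a0] := pivot (symS p Ap) uS.
pose S' q := C *m S q *m C^T; pose a q : R := S' q 0 0.
have cS' : Ck_mx K A S'.
  by apply: Ck_mx_mul => //; [apply: Ck_mx_mul => //|]; exact: Ck_mx_cst.
have ca k : K k -> Ck k A a by move=> Kk; exact: cS'.
(* By continuity the pivot keeps the sign [s] it has at [p] on a neighbourhood [B], which is why the
   signs of the final frame are constant. *)
have [s [B [oB Bp BA ss sa]]] : exists s B, [/\ open B, B p, B `<=` A, is_sign s
    & forall q, B q -> 0 < s * a q].
  pose s : R := Num.sg (a p).
  have sap : 0 < s * a p by rewrite -normrEsg normr_gt0.
  exists s, (A `&` (fun q => s * a q) @^-1` [set x | 0 < x]); split => //.
  - apply: (continuous_inP _ oA).1 => [q /[!inE] Aq|]; last exact: open_gt.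
    apply: (@continuousM R V (fun=> s) a); first exact: cst_continuous.
    exact: Ck_continuous (ca _ Kk0) Aq.
  - rewrite /s /is_sign; case: (ltgtP (a p) 0) => [ap0|ap0|/eqP].
    + by right; rewrite ltr0_sg.
    + by left; rewrite gtr0_sg.
    + by rewrite (negbTE a0).
  - by move=> q [].
have cB f : (forall k, K k -> Ck k A f) -> forall k, K k -> Ck k B f.
  by move=> cf k Kk; apply: Ck_subset BA (cf k Kk).
have sa0 q : B q -> a q != 0.
  by move=> /sa; apply: contraTneq => ->; rewrite mulr0 ltxx.
pose u q := ursubmx (S' q : 'M[R]_(1 + m)).
(* Elimination of the first row and column by the pivot; [T] below is the resulting Schur
   complement, to which the induction hypothesis applies. *)
pose L q : 'M[R]_(1 + m) := block_mx 1%:M 0 (- (a q)^-1 *: (u q)^T) 1%:M.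
have cL : Ck_mx K B L.
  apply: Ck_mx_block => //; try exact: Ck_mx_cst.
  apply: Ck_mx_scale => //.
    move=> k Kk; apply: (@Ck_ext _ _ _ oB _ k (fun q => -1 * (a q)^-1)) => [q _|].
      by rewrite mulN1r.
    by apply: CkM => //; [exact: Ck_cst|apply: CkV => //; exact: cB].
  apply: Ck_mx_tr => // k Kk i j.
  apply: (@Ck_ext _ _ _ oB _ k (fun q => S' q (lshift m i) (rshift 1 j))) => [q _|].
    by rewrite !mxE.
  by apply: cB Kk => k' Kk'; exact: cS'.
have cS'B : Ck_mx K B S' by exact: Ck_mx_subset BA cS'.
pose T q := drsubmx (L q *m (S' q : 'M[R]_(1 + m)) *m (L q)^T).
have symS' q : B q -> (S' q)^T = S' q.
  by move=> /BA Aq; rewrite /S' !trmx_mul trmxK symS // mulmxA.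
have LS q : B q -> L q *m (S' q : 'M[R]_(1 + m)) *m (L q)^T = block_mx (a q)%:M 0 0 (T q).
  move=> Bq.
  have S'E : (S' q : 'M[R]_(1 + m)) =
      block_mx (a q)%:M (u q) (u q)^T (drsubmx (S' q : 'M[R]_(1 + m))).
    rewrite -[LHS](@submxK _ 1 m 1 m); congr block_mx.
      rewrite [LHS]mx11_scalar; congr (_ %:M); rewrite [LHS]mxE [LHS]mxE.
      by congr (fun_of_matrix (S' q) _ _); apply: val_inj.
    by rewrite /u trmx_ursub symS'.
  rewrite -[LHS](@submxK _ 1 m 1 m); congr block_mx => //.
  - rewrite S'E /L tr_block_mx !trmx1 !trmx0 !mulmx_block block_mxKul.
    by rewrite !mulmx1 !mul1mx !mulmx0 !mul0mx !addr0.
  - rewrite S'E /L tr_block_mx !trmx1 !trmx0 !mulmx_block block_mxKur.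
    rewrite !mulmx1 !mul1mx !mul0mx !addr0 linearZ /= trmxK -scalemxAr mul_scalar_mx scalerA.
    by rewrite mulNr mulVf ?sa0// scaleN1r addNr.
  - rewrite S'E /L tr_block_mx !trmx1 !trmx0 !mulmx_block block_mxKdl.
    rewrite !mulmx1 !mul1mx !mulmx0 !addr0 -scalemxAl mul_mx_scalar scalerA.
    by rewrite mulNr mulVf ?sa0// scaleN1r addNr.
have symT q : B q -> (T q)^T = T q.
  by move=> Bq; rewrite /T trmx_drsub trmx_mul trmxK trmx_mul (symS' _ Bq) mulmxA.
have uT : T p \in unitmx.
  have uS' : S' p \in unitmx by rewrite /S' !unitmx_mul uC uS unitmx_tr uC.
  have uL : L p \in unitmx by rewrite /L unitmxE det_lblock !det1 mulr1 unitr1.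
  have : L p *m (S' p : 'M[R]_(1 + m)) *m (L p)^T \in unitmx.
    by rewrite unitmx_mul unitmx_tr unitmx_mul uL andbT; exact: uS'.
  by rewrite LS// unitmxE det_ublock unitrM => /andP[].
have cT : Ck_mx K B T.
  have cT' : Ck_mx K B (fun q => L q *m (S' q : 'M[R]_(1 + m)) *m (L q)^T).
    by apply: Ck_mx_mul => //; [exact: Ck_mx_mul|exact: Ck_mx_tr].
  move=> k Kk i j; apply: Ck_ext (cT' k Kk (rshift 1 i) (rshift 1 j)) => // q _.
  by rewrite [RHS]mxE [RHS]mxE.
have [B' [d [Q [oB' Bp' B'B sd [cQ QTQ]]]]] := IH B T oB Bp cT symT uT.
(* Normalizes the pivot: [r a r = a / (s a) = s], since [s] is a sign. *)
pose r q := (Num.sqrt (s * a q))^-1.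
have cr k : K k -> Ck k B' r.
  move=> Kk; apply: Ck_invsqrt => // [q /B'B /sa //|].
  by apply: CkM => //; [exact: Ck_cst|apply: Ck_subset B'B (cB _ _ ca k Kk)].
exists B', (row_mx s%:M d : 'rV[R]_(1 + m)),
  (fun q => block_mx (r q)%:M 0 0 (Q q) *m L q *m C); split => //.
- by move=> q /B'B/BA.
- move=> i; case: (@split_ordP 1 m i) => i' ->.
    change (is_sign ((row_mx s%:M d : 'rV[R]_(1 + m)) 0 (lshift m i'))).
    by rewrite row_mxEl mxE ord1 eqxx.
  change (is_sign ((row_mx s%:M d : 'rV[R]_(1 + m)) 0 (rshift 1 i'))).
  by rewrite row_mxEr.
split.
  apply: Ck_mx_mul => //; last exact: Ck_mx_cst.
  apply: Ck_mx_mul => //; last exact: Ck_mx_subset B'B cL.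
  apply: (@Ck_mx_block V K B' oB' 1 m 1 m (fun q => (r q)%:M) (fun=> 0) (fun=> 0) Q) => //;
    try exact: Ck_mx_cst.
  move=> k Kk i j; apply: Ck_ext (cr k Kk) => // q _.
  by rewrite !ord1 mxE eqxx.
move=> q B'q; have Bq := B'B _ B'q.
have -> : block_mx (r q)%:M 0 0 (Q q) *m L q *m C *m S q *m
    (block_mx (r q)%:M 0 0 (Q q) *m L q *m C)^T =
    block_mx (r q)%:M 0 0 (Q q) *m (L q *m (S' q : 'M[R]_(1 + m)) *m (L q)^T) *m
    (block_mx (r q)%:M 0 0 (Q q))^T.
  by rewrite /S' !trmx_mul !mulmxA.
rewrite LS// tr_block_mx !mulmx_block !trmx0 !mul0mx !mulmx0 !add0r !addr0.
rewrite (_ : diag_mx _ = block_mx (diag_mx s%:M) 0 0 (diag_mx d)); last exact: diag_mx_row.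
rewrite !mul0mx QTQ// tr_scalar_mx -!scalar_mxM.
suff -> : (r q * a q * r q)%:M = diag_mx (s%:M : 'rV[R]_1) by [].
rewrite [RHS]mx11_scalar !mxE eqxx; congr (_ %:M).
have sa_gt := sa _ Bq.
have ss1 : s * s = 1 by case: ss => ->; rewrite ?mulr1 ?mulrNN ?mulr1.
have rE : r q * r q = (s * a q)^-1 by rewrite /r -invfM -expr2 sqr_sqrtr// ltW.
rewrite mulrAC rE invfM -mulrA mulVf ?sa0// mulr1.
by case: ss => ->; rewrite ?invr1// invrN1.
Qed.

(** If [P] diagonalizes the Gram matrix [X G X^T] of the rows of [X], the rows of [P X] are
    orthonormal and stay in the span of those of [X]. Taking [X = 1] gives frames of the whole
    space, taking [X] vertical gives frames of the fibres. *)
Lemma orthonormal_frame (K : nat -> Prop) (k0 : nat) m r (A : set 'rV[R]_m)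
    (p : 'rV[R]_m) (G : 'rV[R]_m -> 'M[R]_m) (X : 'rV[R]_m -> 'M[R]_(r, m)) :
  K k0 -> open A -> A p -> Ck_mx K A G -> Ck_mx K A X ->
  (forall q, A q -> (G q)^T = G q) -> X p *m G p *m (X p)^T \in unitmx ->
  exists (B : set 'rV[R]_m) (eps : 'I_r -> R) (e : 'I_r -> 'rV[R]_m -> 'rV[R]_m),
    [/\ open B, B p, B `<=` A, orthonormal_on B (fun q => ip (G q)) e eps
      & forall i, (forall k, K k -> Ck k B (e i)) /\
          forall q, (e i q <= X q)%MS].
Proof.
move=> Kk0 oA Ap cG cX symG uS.
pose S q := X q *m G q *m (X q)^T.
have cS : Ck_mx K A S.
  by apply: Ck_mx_mul => //; [exact: Ck_mx_mul|exact: Ck_mx_tr].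
have symS q : A q -> (S q)^T = S q.
  by move=> Aq; rewrite /S !trmx_mul trmxK symG// mulmxA.
have [B [d [P [oB Bp BA sd [cP PSP]]]]] := local_diagonalization Kk0 oA Ap cS symS uS.
exists B, (fun i => d 0 i), (fun i q => row i (P q *m X q)); split => //.
  split=> // q Bq i j; rewrite ip_row trmx_mul !mulmxA.
  have := PSP q Bq; rewrite /S !mulmxA => ->.
  by rewrite !mxE.
move=> i; split=> [k Kk|q]; last first.
  by apply: submx_trans (row_sub _ _) _; exact: submxMl.
apply: Ck_mx_row Kk => // k' Kk' i' j.
have cPX : Ck_mx K B (fun q => P q *m X q).
  by apply: Ck_mx_mul => //; exact: Ck_mx_subset BA cX.
by apply: Ck_ext (cPX k' Kk' i j) => // q _; rewrite [RHS]mxE.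
Qed.

End Frames.

(** * Covariant derivatives in coordinates *)

Section CoordinateCalculus.
Variable R : realType.

Lemma Ck_comp (V : normedModType R) (A : set V) (O : set R) k (F : R -> R) (f : V -> R) :
  open A -> (forall x, A x -> O (f x)) -> Ck k O F -> Ck k A f -> Ck k A (F \o f).
Proof.
move=> oA fO; elim: k F f fO => [|k IH] F f fO cF cf.
  move=> x Ax; apply: continuous_comp; first exact: cf.
  by apply: cF; exact: fO.
split=> [x Ax|v].
  by apply: differentiable_comp; [exact: cf.1|exact: cF.1 _ (fO _ Ax)].
have cFf := IH _ _ fO (cF.2 1) (Ck_pred cf).
apply: Ck_ext (CkM oA cFf (cf.2 v)) => // y Ay.
by rewrite derive_compr//; [exact: cf.1|exact: cF.1 _ (fO _ Ay)].
Qed.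

Lemma ipDm m (G H : 'M[R]_m) v w : ip (G + H) v w = ip G v w + ip H v w.
Proof. by rewrite /ip mulmxDr mulmxDl mxE. Qed.

Lemma ipZm m c (G : 'M[R]_m) v w : ip (c *: G) v w = c * ip G v w.
Proof. by rewrite /ip -scalemxAr -scalemxAl mxE. Qed.

Lemma ipNm m (G : 'M[R]_m) v w : ip (- G) v w = - ip G v w.
Proof. by rewrite /ip mulmxN mulNmx mxE. Qed.

Lemma ip1E m (v w : 'rV[R]_m) : ip 1%:M v w = \sum_a v 0 a * w 0 a.
Proof. by rewrite /ip mulmx1 mxE; apply: eq_bigr => a _; rewrite mxE. Qed.

Lemma ip1C m (v w : 'rV[R]_m) : ip 1%:M v w = ip 1%:M w v.
Proof. by rewrite !ip1E; apply: eq_bigr => a _; rewrite mulrC. Qed.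

Lemma ip_outer m (a c v w : 'rV[R]_m) : ip (a^T *m c) v w = ip 1%:M v a * ip 1%:M w c.
Proof.
rewrite /ip !mulmx1 mulmxA -mulmxA mxE big_ord1.
by congr (_ * _); rewrite -[RHS]trace_mx11 -mxtrace_tr trace_mx11 trmx_mul trmxK.
Qed.

Lemma ip_mul1 m (G : 'M[R]_m) v w : ip G v w = ip 1%:M (v *m G) w.
Proof. by rewrite /ip mulmx1. Qed.

Lemma is_derive_ip (V : normedModType R) m (M : V -> 'M[R]_m) (u w : V -> 'rV[R]_m) p v :
  derivable M p v -> derivable u p v -> derivable w p v ->
  is_derive p v (fun q => ip (M q) (u q) (w q))
  (ip ('D_v M p) (u p) (w p) + ip (M p) ('D_v u p) (w p) + ip (M p) (u p) ('D_v w p)).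
Proof.
move=> dM du dw.
have {}dM' a c := (derivable_mxP M p v).1 dM a c.
have {}du' a := (derivable_mxP u p v).1 du 0 a.
have {}dw' a := (derivable_mxP w p v).1 dw 0 a.
have -> : (fun q => ip (M q) (u q) (w q)) =
    \sum_a \sum_c (fun q => M q a c) * (fun q => u q 0 a) * (fun q => w q 0 c).
  apply/funext => q; rewrite ipE fct_sumE; apply: eq_bigr => a _.
  by rewrite fct_sumE.
have dt a c : is_derive p v ((fun q => M q a c) * (fun q => u q 0 a) * (fun q => w q 0 c))
    ('D_v M p a c * u p 0 a * w p 0 c + M p a c * 'D_v u p 0 a * w p 0 c
      + M p a c * u p 0 a * 'D_v w p 0 c).
  have EM : 'D_v M p a c = 'D_v (fun x => M x a c) p by rewrite (derive_mx dM) mxE.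
  have Eu : 'D_v u p 0 a = 'D_v (fun x => u x 0 a) p by rewrite (derive_mx du) mxE.
  have Ew : 'D_v w p 0 c = 'D_v (fun x => w x 0 c) p by rewrite (derive_mx dw) mxE.
  have D := is_deriveM (is_deriveM (derivableP (dM' a c)) (derivableP (du' a)))
    (derivableP (dw' c)).
  rewrite EM Eu Ew; apply: is_derive_eq D _; rewrite /GRing.scale /=.
  move: ('D_v (fun x => M x a c) p) ('D_v (fun x => u x 0 a) p) ('D_v (fun x => w x 0 c) p)
    => d1 d2 d3.
  change (M p a c * u p 0 a * d3 + w p 0 c * (M p a c * d2 + u p 0 a * d1) =
    d1 * u p 0 a * w p 0 c + M p a c * d2 * w p 0 c + M p a c * u p 0 a * d3).
  ring.
apply: is_derive_eq (is_derive_sum (fun a => is_derive_sum (dt a))) _.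
rewrite !ipE -!big_split; apply: eq_bigr => a _.
by rewrite -!big_split.
Qed.

Section Field.
Variable n : nat.

(** Covectors are row vectors too, paired with vectors through the Euclidean form [ip 1%:M]. *)
Definition dd (v : 'rV[R]_n -> R) (p : 'rV[R]_n) : 'rV[R]_n :=
  \row_a 'D_(delta_mx 0 a) v p.

Definition hess2 (v : 'rV[R]_n -> R) (p : 'rV[R]_n) : 'M[R]_n :=
  \matrix_(a, c) 'D_(delta_mx 0 a) (fun q => 'D_(delta_mx 0 c) v q) p.

Lemma derive_dd (v : 'rV[R]_n -> R) p w :
  differentiable v p -> 'D_w v p = ip 1%:M w (dd v p).
Proof.
move=> dv; rewrite deriveE// {1}[w]row_sum_delta linear_sum ip1E.
by apply: eq_bigr => a _; rewrite linearZ mxE deriveE.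
Qed.

Lemma derivable_dd (A : set 'rV[R]_n) (v : 'rV[R]_n -> R) p w :
  Ck 2 A v -> A p -> derivable (dd v) p w.
Proof.
move=> cv Ap; apply/derivable_mxP => i j.
have -> : (fun q => dd v q i j) = (fun q => 'D_(delta_mx 0 j) v q).
  by apply/funext => q; rewrite mxE.
by apply: diff_derivable; exact: (cv.2 _).1.
Qed.

Lemma derive_dd_row (A : set 'rV[R]_n) (v : 'rV[R]_n -> R) p w :
  Ck 2 A v -> A p -> 'D_w (dd v) p = w *m hess2 v p.
Proof.
move=> cv Ap; rewrite derive_mx; last exact: derivable_dd cv Ap.
apply/rowP => j; rewrite !mxE.
have -> : (fun q => dd v q 0 j) = (fun q => 'D_(delta_mx 0 j) v q).
  by apply/funext => q; rewrite mxE.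
rewrite derive_dd; last exact: (cv.2 _).1.
by rewrite ip1E; apply: eq_bigr => a _; rewrite !mxE.
Qed.

(** Near [p] the function is the pairing of [e] with [dd v], so this is the product rule; the first
    term accounts for the variation of the field [e]. *)
Lemma is_derive_along (A : set 'rV[R]_n) (v : 'rV[R]_n -> R) (e : 'rV[R]_n -> 'rV[R]_n) p w :
  open A -> A p -> Ck 2 A v -> derivable e p w ->
  is_derive p w (fun q => 'D_(e q) v q)
    (ip 1%:M ('D_w e p) (dd v p) + ip (hess2 v p) w (e p)).
Proof.
move=> oA Ap cv de.
have E : \near p, ip 1%:M (e p) (dd v p) = 'D_(e p) v p.
  apply: (open_near_eq oA Ap) => q Aq.
  by rewrite derive_dd//; exact: cv.1.
apply: (near_eq_is_derive E).
have dcst : derivable (fun _ : 'rV[R]_n => 1%:M : 'M[R]_n) p w by exact: derivable_cst.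
have dD : derivable (dd v) p w by exact: derivable_dd cv Ap.
apply: is_derive_eq (is_derive_ip dcst de dD) _.
rewrite derive_cst (derive_dd_row _ cv)//.
rewrite (_ : ip 0 _ _ = 0) ?add0r; last by rewrite /ip mulmx0 mul0mx mxE.
by congr (_ + _); rewrite ip1C -ip_mul1.
Qed.

End Field.

(** Christoffel symbols with the upper index contracted against a covector. The covariant Hessian of
    [v] is thus [hess2 v p - chr G p (dd v p)]. *)
Definition chr m (G : 'rV[R]_m -> 'M[R]_m) (p th : 'rV[R]_m) : 'M[R]_m :=
  \matrix_(a, c) \sum_d christoffel G p a c d * th 0 d.

Lemma cov_along_ip k m (G : 'rV[R]_m -> 'M[R]_m) (F V : 'rV[R]_k -> 'rV[R]_m) p w th :
  ip 1%:M (cov_along G F V p w) th =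
  ip 1%:M ('D_w V p) th + ip (chr G (F p) th) ('D_w F p) (V p).
Proof.
rewrite ipDl; congr (_ + _); rewrite ip1E ipE.
under eq_bigr => c _.
  rewrite mxE mulr_suml.
  under eq_bigr => a _ do rewrite mulr_suml.
  over.
rewrite exchange_big; apply: eq_bigr => a _ /=.
rewrite exchange_big; apply: eq_bigr => c _ /=.
rewrite mxE !mulr_suml; apply: eq_bigr => d _.
by ring.
Qed.

Lemma derive_mx_sum m n (G : 'rV[R]_m -> 'M[R]_n) p v :
  (forall a c, differentiable (fun q => G q a c) p) ->
  'D_v G p = \sum_d v 0 d *: 'D_(delta_mx 0 d) G p.
Proof.
move=> dG.
have dGv w : derivable G p w.
  by apply/derivable_mxP => a c; apply: diff_derivable.
apply/matrixP => a c; rewrite derive_mx// mxE summxE derive_dd// ip1E.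
by apply: eq_bigr => d _; rewrite derive_mx// !mxE.
Qed.

(* The Koszul formula, contracted with the covector th and evaluated on the
   diagonal. *)
Lemma chr_diag m (G : 'rV[R]_m -> 'M[R]_m) (A : set 'rV[R]_m) p th X :
  open A -> A p -> (forall q, A q -> (G q)^T = G q) ->
  (forall a c, differentiable (fun q => G q a c) p) ->
  ip (chr G p th) X X =
  ip ('D_X G p) (th *m invmx (G p)) X - 2^-1 * ip ('D_(th *m invmx (G p)) G p) X X.
Proof.
move=> oA Ap symG dG; set N := th *m invmx (G p).
pose D d a c := 'D_(delta_mx 0 d) (fun q => G q a c) p.
have DE v a c : 'D_v G p a c = \sum_d v 0 d * D d a c.
  rewrite derive_mx_sum// summxE; apply: eq_bigr => d _.
  rewrite derive_mx ?mxE//.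
  by apply/derivable_mxP => i j; apply: diff_derivable.
have Dsym d a c : D d a c = D d c a.
  apply: near_eq_derive; apply: (open_near_eq oA Ap) => q Aq.
  by rewrite -[in LHS](symG q Aq) mxE.
have chrE a c : chr G p th a c = 2^-1 * \sum_d N 0 d * (D a d c + D c a d - D d a c).
  rewrite mxE /christoffel mulr_sumr.
  under eq_bigr => d _ do rewrite -mulrA mulr_suml mulr_sumr.
  rewrite exchange_big; apply: eq_bigr => d _ /=.
  rewrite mxE mulr_suml mulr_sumr; apply: eq_bigr => f _.
  by rewrite -/(D a d c) -/(D c a d) -/(D d a c) mulrAC [th 0 f * _]mulrC.
pose S := \sum_a \sum_c \sum_d N 0 d * X 0 c * X 0 a * D a d c.
pose S' := \sum_a \sum_c \sum_d N 0 d * X 0 c * X 0 a * D d a c.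
have -> : ip ('D_X G p) N X = S.
  rewrite ipE /S.
  under eq_bigr => a _ do under eq_bigr => c _ do rewrite DE !mulr_suml.
  rewrite exchange_big [RHS]exchange_big /=; apply: eq_bigr => c _.
  rewrite exchange_big /=; apply: eq_bigr => a _; apply: eq_bigr => d _.
  by ring.
have -> : ip ('D_N G p) X X = S'.
  rewrite ipE /S'; apply: eq_bigr => a _; apply: eq_bigr => c _.
  by rewrite DE !mulr_suml; apply: eq_bigr => d _; ring.
rewrite ipE.
have -> : \sum_a \sum_c chr G p th a c * X 0 a * X 0 c =
  2^-1 * (S + \sum_a \sum_c \sum_d N 0 d * X 0 c * X 0 a * D c a d - S').
  rewrite mulrBr mulrDr !mulr_sumr -big_split -sumrB; apply: eq_bigr => a _ /=.
  rewrite !mulr_sumr -big_split -sumrB; apply: eq_bigr => c _ /=.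
  rewrite chrE !mulr_sumr !mulr_suml -big_split -sumrB; apply: eq_bigr => d _ /=.
  by ring.
(* On the diagonal, the first two Koszul terms agree after exchanging [a] and [c]; together they
   cancel the factor one half. *)
have -> : \sum_a \sum_c \sum_d N 0 d * X 0 c * X 0 a * D c a d = S.
  rewrite exchange_big; apply: eq_bigr => a _; apply: eq_bigr => c _.
  by apply: eq_bigr => d _; rewrite Dsym; ring.
by field.
Qed.

End CoordinateCalculus.

(** * Mean curvature of graphs in a warped product *)

Section Graph.
Variables (R : realType) (n : nat).
Implicit Types (A : set 'rV[R]_n) (G : 'rV[R]_n -> 'M[R]_n) (w : 'rV[R]_n -> R).

(* [warp] and [graph_map] are [warped] and [graph] in a fixed chart, to which
   they are convertible. *)
Definition warp (b : R -> R) G (p : 'rV[R]_(n + 1)) : 'M[R]_(n + 1) :=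
  block_mx (b (rsubmx p 0 0) ^+ 2 *: G (lsubmx p)) 0 0 (-1)%:M.

Definition graph_map w (y : 'rV[R]_n) : 'rV[R]_(n + 1) := row_mx y (w y)%:M.

Lemma differentiable_row (V : normedModType R) m (M : V -> 'rV[R]_m) p :
  (forall j, differentiable (fun q => M q 0 j) p) -> differentiable M p.
Proof.
move=> dM.
have -> : M = \sum_j (fun q => M q 0 j *: delta_mx 0 j).
  by apply/funext => q; rewrite fct_sumE [LHS]row_sum_delta.
apply: differentiable_sum => j.
by apply: differentiableZl; exact: dM.
Qed.

Lemma is_derive_row_mx (V : normedModType R) (u : V -> 'rV[R]_n) (s : V -> R) p z :
  derivable u p z -> derivable s p z ->
  is_derive p z (fun q => row_mx (u q) (s q)%:M : 'rV[R]_(n + 1))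
    (row_mx ('D_z u p) ('D_z s p)%:M).
Proof.
move=> du ds.
have El j : (fun q => (row_mx (u q) (s q)%:M : 'rV[R]_(n + 1)) 0 (lshift 1 j)) =
    (fun q => u q 0 j).
  by apply/funext => q; rewrite row_mxEl.
have Er j : (fun q => (row_mx (u q) (s q)%:M : 'rV[R]_(n + 1)) 0 (rshift n j)) = s.
  by apply/funext => q; rewrite row_mxEr !ord1 mxE eqxx.
have du' a := (derivable_mxP u p z).1 du 0 a.
have dm : derivable (fun q => row_mx (u q) (s q)%:M : 'rV[R]_(n + 1)) p z.
  apply/derivable_mxP => i j; rewrite ord1.
  by case: (split_ordP j) => k ->; rewrite ?El ?Er.
apply: DeriveDef => //; rewrite (derive_mx dm); apply/rowP => j; rewrite mxE.
case: (split_ordP j) => k ->; rewrite ?El ?Er ?row_mxEl ?row_mxEr.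
  by rewrite (derive_mx du) mxE.
by rewrite !ord1 mxE eqxx.
Qed.

Lemma derive_coord m (p z : 'rV[R]_m) j :
  'D_z (fun q : 'rV[R]_m => q 0 j) p = z 0 j.
Proof.
have did : derivable (@id 'rV[R]_m) p z by exact: derivable_id.
by have := derive_mx did; rewrite derive_id => /rowP/(_ j); rewrite mxE.
Qed.

Lemma derive_graph w q z : differentiable w q ->
  'D_z (graph_map w) q = row_mx z ('D_z w q)%:M.
Proof.
move=> dw; have did : derivable (@id 'rV[R]_n) q z by exact: derivable_id.
have [_ ->] := is_derive_row_mx did (diff_derivable (v := z) dw).
by rewrite derive_id.
Qed.

Lemma differentiable_graph w q : differentiable w q -> differentiable (graph_map w) q.
Proof.
move=> dw; apply: differentiable_row => j.
case: (split_ordP j) => k ->.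
  have -> : (fun q => graph_map w q 0 (lshift 1 k)) = (fun q => q 0 k).
    by apply/funext => r; rewrite row_mxEl.
  exact: differentiable_coord.
have -> : (fun q => graph_map w q 0 (rshift n k)) = w.
  by apply/funext => r; rewrite row_mxEr !ord1 mxE eqxx.
exact: dw.
Qed.

Lemma ip_block (M : 'M[R]_n) c (x z : 'rV[R]_n) s t :
  ip (block_mx M 0 0 c%:M : 'M[R]_(n + 1)) (row_mx x s%:M) (row_mx z t%:M) =
  ip M x z + c * (s * t).
Proof.
rewrite /ip mul_row_block !mulmx0 addr0 add0r tr_row_mx mul_row_col mxE.
by congr (_ + _); rewrite tr_scalar_mx -!scalar_mxM mxE eqxx mulrAC mulrC.
Qed.

Lemma ip1_row (x z : 'rV[R]_n) s t :
  ip (1%:M : 'M[R]_(n + 1)) (row_mx x s%:M) (row_mx z t%:M) = ip 1%:M x z + s * t.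
Proof. by rewrite -[s * t]mul1r -ip_block -scalar_mx_block. Qed.

Definition induced_gram (b : R -> R) G w (y : 'rV[R]_n) : 'M[R]_n :=
  b (w y) ^+ 2 *: G y - (dd w y)^T *m dd w y.

Lemma warp_graph b G w y :
  warp b G (graph_map w y) = block_mx (b (w y) ^+ 2 *: G y) 0 0 (-1)%:M.
Proof. by rewrite /warp /graph_map row_mxKl row_mxKr mxE eqxx. Qed.

Lemma induced_formE b G w y x z : differentiable w y ->
  induced_form (warp b G) (graph_map w) y x z = ip (induced_gram b G w y) x z.
Proof.
move=> dw; rewrite /induced_form !derive_graph// warp_graph ip_block.
by rewrite ipDm ipNm ip_outer mulN1r !derive_dd.
Qed.

Lemma jacobian_graph w y : differentiable w y ->
  'J (graph_map w) y = row_mx 1%:M (dd w y)^T.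
Proof.
move=> dw; apply/row_matrixP => i; rewrite !rowE -deriveEjacobian.
  rewrite derive_graph// mul_mx_row mulmx1; congr row_mx.
  rewrite [RHS]mx11_scalar; congr (_ %:M).
  by rewrite derive_dd// /ip mulmx1.
exact: differentiable_graph.
Qed.

(** The tangent space of the graph is the kernel of the conormal [(- dw, 1)]. As the induced metric
    is non-degenerate, tangent and normal spaces are complementary, so the normal part of [z]
    vanishes exactly when [z] is tangent. *)
Lemma normal_at_eq0 b G w y (z : 'rV[R]_(n + 1)) :
  differentiable w y -> induced_gram b G w y \in unitmx ->
  (z *m normal_at (warp b G) (graph_map w) y = 0) <->
  ip 1%:M z (row_mx (- dd w y) 1%:M) = 0.
Proof.
move=> dw uga; rewrite /normal_at /normal_proj jacobian_graph//.
set D := row_mx _ _; set W := warp _ _ _.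
have gaE : D *m W *m D^T = induced_gram b G w y.
  rewrite /W warp_graph /D mul_row_block !mulmx0 addr0 add0r tr_row_mx mul_row_col.
  by rewrite trmx1 mul1mx mulmx1 trmxK mul_mx_scalar scaleN1r mulNmx.
have direct : (kermx (W *m D^T) :&: <<D>>)%MS = 0.
  apply/eqP; rewrite -submx0; apply/rV_subP => x.
  rewrite sub_capmx => /andP[/sub_kermxP xK]; rewrite genmxE => /submxP[c xE].
  move: xK; rewrite xE mulmxA -mulmxA mulmxA -[c *m D *m W]mulmxA -mulmxA gaE => cg.
  by rewrite -[c](mulmxK uga) cg mul0mx mul0mx sub0mx.
have full : (z <= kermx (W *m D^T) + <<D>>)%MS.
  (* Coefficients of the tangential part of [z], obtained by solving the linear system whose matrix
     is the induced Gram matrix. *)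
  pose c := z *m (W *m D^T) *m invmx (induced_gram b G w y).
  rewrite -[z](subrK (c *m D)); apply: addmx_sub_adds.
    apply/sub_kermxP; rewrite mulmxBl -[c *m D *m _]mulmxA [D *m (W *m _)]mulmxA gaE.
    by rewrite /c mulmxKV// subrr.
  by rewrite genmxE submxMl.
have zD : (z <= D)%MS <-> ip 1%:M z (row_mx (- dd w y) 1%:M) = 0.
  rewrite -[z]hsubmxK [rsubmx z]mx11_scalar ip1_row mulr1 -scaleN1r ipZr mulN1r.
  split.
    move=> /submxP[c]; rewrite mul_mx_row mulmx1 => /eq_row_mx[-> cE].
    have := congr1 (fun M : 'M[R]_1 => M 0 0) cE; rewrite mxE eqxx mulr1n => ->.
    by rewrite /ip mulmx1 addNr.
  move=> /eqP; rewrite addrC subr_eq0 => /eqP ->.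
  apply/submxP; exists (lsubmx z); rewrite mul_mx_row mulmx1; congr row_mx.
  by rewrite [RHS]mx11_scalar /ip mulmx1.
split.
  move=> z0; apply/zD.
  by have := proj_mx_compl_sub full; rewrite z0 subr0 genmxE.
by move=> /zD zDD; apply: proj_mx_0 => //; rewrite genmxE.
Qed.

Lemma derive_comp_linear (V V' W : normedModType R) (L : {linear V -> V'})
    (F : V' -> W) p v :
  continuous L -> differentiable F (L p) -> 'D_v (F \o L) p = 'D_(L v) F (L p).
Proof.
move=> cL dF; have dL : differentiable L p by exact: linear_differentiable.
rewrite deriveE; last exact: differentiable_comp.
by rewrite diff_comp // diff_lin// /= deriveE.
Qed.

(** * Christoffel symbols of the warped product *)

Section Warped.
Variables (A : set 'rV[R]_n) (G : 'rV[R]_n -> 'M[R]_n) (b : R -> R).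
Hypotheses (oA : open A) (symG : forall q, A q -> (G q)^T = G q).
Hypotheses (dG : forall q, A q -> forall a c, differentiable (fun q => G q a c) q).
Variable p : 'rV[R]_(n + 1).
Hypotheses (Ap : A (lsubmx p)) (db : differentiable b (rsubmx p 0 0)).

Lemma derivable_metric q v : A q -> derivable G q v.
Proof. by move=> Aq; apply/derivable_mxP => a c; apply: diff_derivable; exact: dG. Qed.

Lemma differentiable_last (q : 'rV[R]_(n + 1)) :
  differentiable (fun q : 'rV[R]_(n + 1) => rsubmx q 0 0) q.
Proof.
have -> : (fun q : 'rV[R]_(n + 1) => rsubmx q 0 0) = (fun q => q 0 (rshift n 0)).
  by apply/funext => r; rewrite mxE.
exact: differentiable_coord.
Qed.

Lemma differentiable_conformal :
  differentiable (fun q : 'rV[R]_(n + 1) => b (rsubmx q 0 0) ^+ 2) p.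
Proof.
apply: (@differentiable_comp _ _ _ _ (fun q : 'rV[R]_(n + 1) => rsubmx q 0 0) (fun t => b t ^+ 2)).
  exact: differentiable_last.
have -> : (fun t => b t ^+ 2) = b * b by apply/funext => t; rewrite expr2.
exact: differentiableM.
Qed.

Lemma derive_conformal v :
  'D_v (fun q : 'rV[R]_(n + 1) => b (rsubmx q 0 0) ^+ 2) p =
  2 * b (rsubmx p 0 0) * 'D_1 b (rsubmx p 0 0) * rsubmx v 0 0.
Proof.
have -> : (fun q : 'rV[R]_(n + 1) => b (rsubmx q 0 0) ^+ 2) =
   (b * b) \o (fun q : 'rV[R]_(n + 1) => rsubmx q 0 0).
  by apply/funext => q; rewrite expr2.
rewrite derive_compr; [|exact: differentiable_last|exact: differentiableM].
congr (_ * _); last first.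
  have -> : (fun q : 'rV[R]_(n + 1) => rsubmx q 0 0) = (fun q => q 0 (rshift n 0)).
    by apply/funext => r; rewrite mxE.
  by rewrite derive_coord mxE.
rewrite deriveM; try exact/diff_derivable.
by rewrite /GRing.scale /=; ring.
Qed.

Lemma differentiable_block a c :
  differentiable (fun q : 'rV[R]_(n + 1) => G (lsubmx q) a c) p.
Proof.
apply: (@differentiable_comp _ _ _ _ (lsubmx : 'rV[R]_(n + 1) -> 'rV[R]_n) (fun q => G q a c)).
  exact: differentiable_lsubmx.
exact: dG.
Qed.

Lemma warpEul a c : (fun q => warp b G q (lshift 1 a) (lshift 1 c)) =
  (fun q => b (rsubmx q 0 0) ^+ 2) * (fun q => G (lsubmx q) a c).
Proof. by apply/funext => q; rewrite /warp block_mxEul mxE. Qed.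

Lemma warpEur a c : (fun q => warp b G q (lshift 1 a) (rshift n c)) = cst 0.
Proof. by apply/funext => q; rewrite /warp block_mxEur mxE. Qed.

Lemma warpEdl a c : (fun q => warp b G q (rshift n a) (lshift 1 c)) = cst 0.
Proof. by apply/funext => q; rewrite /warp block_mxEdl mxE. Qed.

Lemma warpEdr a c : (fun q => warp b G q (rshift n a) (rshift n c)) = cst ((-1)%:M a c).
Proof. by apply/funext => q; rewrite /warp block_mxEdr. Qed.

Lemma differentiable_warp a c : differentiable (fun q => warp b G q a c) p.
Proof.
case: (split_ordP a) => a' ->; case: (split_ordP c) => c' ->.
- rewrite warpEul.
  by apply: differentiableM; [exact: differentiable_conformal|exact: differentiable_block].
- by rewrite warpEur; exact: differentiable_cst.
- by rewrite warpEdl; exact: differentiable_cst.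
- by rewrite warpEdr; exact: differentiable_cst.
Qed.

Lemma derive_warp v :
  'D_v (warp b G) p =
  block_mx ((2 * b (rsubmx p 0 0) * 'D_1 b (rsubmx p 0 0) * rsubmx v 0 0) *: G (lsubmx p)
    + b (rsubmx p 0 0) ^+ 2 *: 'D_(lsubmx v) G (lsubmx p)) 0 0 0%:M :> 'M[R]_(n + 1).
Proof.
have dW : derivable (warp b G) p v.
  by apply/derivable_mxP => a c; apply: diff_derivable; exact: differentiable_warp.
rewrite (derive_mx dW); apply/matrixP => a c; rewrite mxE.
case: (split_ordP a) => a' ->; case: (split_ordP c) => c' ->.
- rewrite warpEul deriveM; try apply: diff_derivable;
    [|exact: differentiable_conformal|exact: differentiable_block].
  rewrite derive_conformal block_mxEul [RHS]mxE [X in _ = X + _]mxE [X in _ = _ + X]mxE.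
  have -> : 'D_v (fun q : 'rV[R]_(n + 1) => G (lsubmx q) a' c') p =
      'D_(lsubmx v) G (lsubmx p) a' c'.
    have dGv : derivable G (lsubmx p) (lsubmx v) by exact: derivable_metric.
    rewrite (derive_mx dGv) mxE.
    by apply: (@derive_comp_linear _ _ _ lsubmx (fun q => G q a' c') p v);
      [exact: continuous_lsubmx|exact: dG].
  by rewrite /GRing.scale /=; ring.
- by rewrite warpEur derive_cst block_mxEur mxE.
- by rewrite warpEdl derive_cst block_mxEdl mxE.
- by rewrite warpEdr derive_cst block_mxEdr mxE mul0rn.
Qed.

Lemma ip_derive_warp v x s x' s' :
  ip ('D_v (warp b G) p) (row_mx x s%:M) (row_mx x' s'%:M) =
  2 * b (rsubmx p 0 0) * 'D_1 b (rsubmx p 0 0) * rsubmx v 0 0 * ip (G (lsubmx p)) x x'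
  + b (rsubmx p 0 0) ^+ 2 * ip ('D_(lsubmx v) G (lsubmx p)) x x'.
Proof. by rewrite derive_warp ip_block mul0r addr0 ipDm !ipZm. Qed.

Lemma sym_warp q : A (lsubmx q) -> (warp b G q)^T = warp b G q.
Proof.
by move=> Aq; rewrite /warp tr_block_mx !trmx0 tr_scalar_mx linearZ /= symG.
Qed.

(* In a warped product, the vertical covariant derivative picks up b b' g and
   the mixed one 2 b'/b. *)
Lemma chr_warp (th x : 'rV[R]_n) :
  let bp := b (rsubmx p 0 0) in
  bp != 0 -> G (lsubmx p) \in unitmx ->
  let t := ip 1%:M x th in
  ip (chr (warp b G) p (row_mx (- th) 1%:M)) (row_mx x t%:M) (row_mx x t%:M) =
  - ip (chr G (lsubmx p) th) x x
  + bp * 'D_1 b (rsubmx p 0 0) * ip (G (lsubmx p)) x x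
  - 2 * ('D_1 b (rsubmx p 0 0) / bp) * t ^+ 2.
Proof.
move=> bp bp0 uG t; set db1 := 'D_1 b _; set Gp := G (lsubmx p).
pose gr := th *m invmx Gp.
(* The vector dual to the conormal [(- th, 1)] for the warped metric: horizontal lengths contribute
   [b^-2], and [- dt^2] the last sign. *)
pose N : 'rV[R]_(n + 1) := row_mx (- (bp ^- 2 *: gr)) (-1)%:M.
have WN : row_mx (- th) 1%:M *m invmx (warp b G p) = N.
  have uW : warp b G p \in unitmx.
    rewrite /warp unitmxE det_ublock unitrM -!unitmxE unitmxZ ?unitfE ?expf_neq0// uG /=.
    by rewrite unitmxE det_scalar1 unitrN1.
  rewrite -[RHS](mulmxK uW); congr (_ *m _).
  rewrite /N /warp mul_row_block !mulmx0 addr0 add0r -scalar_mxM mulrNN mulr1.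
  congr row_mx; rewrite mulNmx -scalemxAr -scalemxAl scalerA mulfV ?expf_neq0// scale1r.
  by rewrite /gr mulmxKV.
have oA' : open ((lsubmx : 'rV[R]_(n + 1) -> 'rV[R]_n) @^-1` A).
  by apply: open_comp => // q _; exact: continuous_lsubmx.
have symW q : ((lsubmx : 'rV[R]_(n + 1) -> 'rV[R]_n) @^-1` A) q -> (warp b G q)^T = warp b G q.
  exact: sym_warp.
have E0 := @chr_diag R _ (warp b G) _ p (row_mx (- th) 1%:M) (row_mx x t%:M) oA' Ap
  symW differentiable_warp.
rewrite WN in E0.
have lin : 'D_(- (bp ^- 2 *: gr)) G (lsubmx p) = (- bp ^- 2) *: 'D_gr G (lsubmx p).
  rewrite -scaleNr !(derive_mx_sum _ (dG Ap)) scaler_sumr; apply: eq_bigr => a _.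
  by rewrite scalerA mxE.
have c00 c : (c%:M : 'M[R]_1) 0 0 = c by rewrite mxE eqxx.
have E1 : ip ('D_(row_mx x t%:M) (warp b G) p) N (row_mx x t%:M) =
    2 * bp * db1 * t * (- bp ^- 2 * t) + bp ^+ 2 * (- bp ^- 2 * ip ('D_x G (lsubmx p)) gr x).
  apply: etrans (ip_derive_warp _ _ _ _ _) _.
  rewrite row_mxKl row_mxKr c00 -scaleNr !ipZl.
  by rewrite [ip _ gr x]ip_mul1 /gr mulmxKV// ip1C.
have E2 : ip ('D_N (warp b G) p) (row_mx x t%:M) (row_mx x t%:M) =
    2 * bp * db1 * (-1) * ip Gp x x + bp ^+ 2 * (- bp ^- 2 * ip ('D_gr G (lsubmx p)) x x).
  apply: etrans (ip_derive_warp _ _ _ _ _) _.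
  rewrite /N row_mxKl row_mxKr c00; congr (_ + _ * _).
  by rewrite lin ipZm.
apply: (etrans E0); apply: (etrans (congr2 (fun u v => u - 2^-1 * v) E1 E2)).
have CG : ip (chr G (lsubmx p) th) x x =
    ip ('D_x G (lsubmx p)) gr x - 2^-1 * ip ('D_gr G (lsubmx p)) x x.
  exact: (@chr_diag R _ G A _ th x oA Ap symG (dG Ap)).
rewrite {}CG {E0 E1 E2 lin WN}.
generalize (ip ('D_x G (lsubmx p)) gr x) (ip ('D_gr G (lsubmx p)) x x) (ip Gp x x).
rewrite {N}; clearbody bp db1 t => u v z; field.
exact: bp0.
Qed.

End Warped.

(** * The mean curvature of a graph as a trace *)

Section MeanCurvature.
Variables (A : set 'rV[R]_n) (G : 'rV[R]_n -> 'M[R]_n) (O : set R) (b : R -> R).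
Variable w : 'rV[R]_n -> R.
Hypotheses (oA : open A) (symG : forall q, A q -> (G q)^T = G q).
Hypothesis cG : forall a c, Ck 1 A (fun q => G q a c).
Hypotheses (cb : Ck 1 O b) (wO : forall q, A q -> O (w q)) (cw : Ck 2 A w).
Variable y : 'rV[R]_n.
Hypotheses (Ay : A y) (b0 : b (w y) != 0) (uG : G y \in unitmx).
Hypothesis uga : induced_gram b G w y \in unitmx.

(* Its trace for the induced metric is the pairing of the mean curvature vector
   with the conormal (- dw, 1). *)
Definition graph_form : 'M[R]_n :=
  hess2 w y - chr G y (dd w y) + (b (w y) * 'D_1 b (w y)) *: G y
  - (2 * ('D_1 b (w y) / b (w y))) *: ((dd w y)^T *m dd w y).

Lemma ip_suml m (M : 'M[R]_m) k (u : 'I_k -> 'rV[R]_m) v :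
  ip M (\sum_i u i) v = \sum_i ip M (u i) v.
Proof.
apply: (big_morph (fun u => ip M u v)) => [x z|]; first by rewrite ipDl.
by rewrite /ip !mul0mx mxE.
Qed.

(** The derivative of the field [e] enters both components of the second derivative of the graph
    map, and the conormal [(- dw, 1)] cancels the two; what remains depends on [e] only through its
    value at [y]. *)
Lemma cov_graph (V : set 'rV[R]_n) (e : 'rV[R]_n -> 'rV[R]_n) :
  open V -> V y -> V `<=` A -> Ck 1 V e ->
  ip 1%:M (cov_along (warp b G) (graph_map w) (fun q => 'D_(e q) (graph_map w) q) y (e y))
    (row_mx (- dd w y) 1%:M) = ip graph_form (e y) (e y).
Proof.
move=> oV Vy VA ce.
have dw q : A q -> differentiable w q by exact: cw.1.
have de : derivable e y (e y) by apply: diff_derivable; exact: ce.1.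
have dew := is_derive_along oA Ay cw de.
have DE : 'D_(e y) (fun q => 'D_(e q) (graph_map w) q) y =
    row_mx ('D_(e y) e y)
      (ip 1%:M ('D_(e y) e y) (dd w y) + ip (hess2 w y) (e y) (e y))%:M.
  transitivity ('D_(e y) (fun q => row_mx (e q) ('D_(e q) w q)%:M : 'rV[R]_(n + 1)) y).
    apply: near_eq_derive; apply: (open_near_eq oV Vy) => q Vq.
    by rewrite derive_graph//; exact: dw (VA _ Vq).
  have dew' : derivable (fun q => 'D_(e q) w q) y (e y) by case: dew.
  have [_ ->] := is_derive_row_mx de dew'.
  by have [_ ->] := dew.
rewrite cov_along_ip DE ip1_row mulr1 (derive_graph _ (dw _ Ay)) (derive_dd _ (dw _ Ay)).
have dGq q : A q -> forall a c, differentiable (fun q => G q a c) q.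
  by move=> Aq a c; exact: (cG a c).1.
have gl : lsubmx (graph_map w y) = y by rewrite /graph_map row_mxKl.
have gr : rsubmx (graph_map w y) 0 0 = w y by rewrite /graph_map row_mxKr mxE eqxx.
have Agr : A (lsubmx (graph_map w y)) by rewrite gl.
have dbgr : differentiable b (rsubmx (graph_map w y) 0 0).
  by rewrite gr; apply: cb.1; exact: wO.
have := chr_warp oA symG dGq Agr dbgr (dd w y) (e y).
rewrite /= gl gr => -> //.
rewrite /graph_form !ipDm !ipNm !ipZm ip_outer -scaleN1r ipZr expr2.
by ring.
Qed.

(** An equality of normal parts amounts to one scalar equation, the pairing with the conormal, and
    the sum over an orthonormal frame is a trace. *)
Lemma mean_curvature_frame (V : set 'rV[R]_n) (e : 'I_n -> 'rV[R]_n -> 'rV[R]_n)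
    (eps : 'I_n -> R) :
  open V -> V y -> V `<=` A -> (forall i, Ck 1 V (e i)) ->
  orthonormal_on V (induced_form (warp b G) (graph_map w)) e eps ->
  b (w y) *: (partial_t R n *m normal_at (warp b G) (graph_map w) y) =
  \sum_i eps i *: (cov_along (warp b G) (graph_map w)
      (fun q => 'D_(e i q) (graph_map w) q) y (e i y) *m normal_at (warp b G) (graph_map w) y)
  <-> b (w y) = \tr (invmx (induced_gram b G w y) *m graph_form).
Proof.
move=> oV Vy VA ce [seps one].
have dw : differentiable w y by exact: cw.1.
set Nm := normal_at _ _ _.
pose C i := cov_along (warp b G) (graph_map w) (fun q => 'D_(e i q) (graph_map w) q) y (e i y).
have -> : \sum_i eps i *: (C i *m Nm) = (\sum_i eps i *: C i) *m Nm.
  by rewrite mulmx_suml; apply: eq_bigr => i _; rewrite scalemxAl.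
rewrite scalemxAl.
have trE : \sum_i eps i * ip graph_form (e i y) (e i y) =
    \tr (invmx (induced_gram b G w y) *m graph_form).
  rewrite -(@trace_frame R n _ graph_form (fun i => e i y) eps).
  - by apply: eq_bigr => i _; case: (seps i) => ->; rewrite ?invr1 ?invrN1.
  - by move=> i; case: (seps i) => ->; rewrite ?oppr_eq0 oner_eq0.
  - by move=> i j; rewrite -induced_formE// one.
have ipE' : ip 1%:M (b (w y) *: partial_t R n - \sum_i eps i *: C i)
    (row_mx (- dd w y) 1%:M) = b (w y) - \sum_i eps i * ip graph_form (e i y) (e i y).
  rewrite ipDl ipZl ip1_row /ip mul0mx mul0mx mxE add0r !mulr1 -/(ip _ _ _) -scaleN1r ipZl mulN1r.
  congr (_ - _); rewrite ip_suml; apply: eq_bigr => i _.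
  by rewrite ipZl (cov_graph oV Vy VA (ce i)).
rewrite -trE; split=> [E|E].
  apply/eqP; rewrite -subr_eq0 -ipE'; apply/eqP.
  by apply/(normal_at_eq0 _ dw uga); rewrite mulmxBl E subrr.
apply/eqP; rewrite -subr_eq0 -mulmxBl; apply/eqP.
by apply/(normal_at_eq0 _ dw uga); rewrite ipE' E subrr.
Qed.

(** The trace does not depend on the frame, so it settles the quantification over all frames in one
    direction. The other direction evaluates the hypothesis on one frame, which therefore has to be
    built. *)
Lemma graph_soliton_eq :
  is_mean_curvature (warp b G) A (graph_map w) y
    (b (w y) *: (partial_t R n *m normal_at (warp b G) (graph_map w) y))
  <-> b (w y) = \tr (invmx (induced_gram b G w y) *m graph_form).
Proof.
split; last by move=> E V e eps oV Vy VA ce one; exact/(mean_curvature_frame oV Vy VA ce one).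
have c1w : Ck 1 A w by exact: Ck_pred.
have cbw : Ck 1 A (fun q => b (w q)) by apply: Ck_comp cb c1w.
have cdd j : Ck 1 A (fun q => dd w q 0 j).
  apply: (@Ck_ext _ _ _ oA _ 1 (fun q => 'D_(delta_mx 0 j) w q)) => [q _|].
    by rewrite mxE.
  exact: cw.2.
(* The induced metric contains first derivatives of the C^2 function [w], so it is of class C^1, as
   will be the frame. *)
have cga : Ck_mx (fun k => k = 1%N) A (induced_gram b G w).
  move=> k -> i j.
  apply: (@Ck_ext _ _ _ oA _ 1 (fun q => (b (w q) * b (w q)) * G q i j
    + -1 * (dd w q 0 i * dd w q 0 j))).
    by move=> q _; rewrite !mxE big_ord1 !mxE expr2 mulN1r.
  exact: (CkD oA (CkM oA (CkM oA cbw cbw) (cG i j))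
    (CkM oA (Ck_cst oA 1 (-1 : R)) (CkM oA (cdd i) (cdd j)))).
have cX : Ck_mx (fun k => k = 1%N) A (fun _ : 'rV[R]_n => 1%:M : 'M[R]_n) by exact: Ck_mx_cst.
have symga q : A q -> (induced_gram b G w q)^T = induced_gram b G w q.
  by move=> Aq; rewrite /induced_gram linearB linearZ /= symG// trmx_mul trmxK.
have uga' : 1%:M *m induced_gram b G w y *m (1%:M)^T \in unitmx.
  by rewrite mul1mx trmx1 mulmx1.
have [V [eps [e [oV Vy VA [seps one] ceX]]]] :=
  orthonormal_frame (erefl 1%N) oA Ay cga cX symga uga'.
have ce i : Ck 1 V (e i) by exact: (ceX i).1.
have one' : orthonormal_on V (induced_form (warp b G) (graph_map w)) e eps.
  split=> // q Vq i j; rewrite induced_formE ?one//.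
  by apply: cw.1; exact: VA.
move=> /(_ V e eps oV Vy VA ce one') E.
by apply/(mean_curvature_frame oV Vy VA ce one').
Qed.

End MeanCurvature.

End Graph.

(** * Gradient, Hessian and fibres of the submersion *)

Section Submersions.
Variables (R : realType).

Lemma inj_unitmx m (M : 'M[R]_m) : (forall c : 'rV_m, c *m M = 0 -> c = 0) -> M \in unitmx.
Proof. by move=> inj; rewrite -row_free_unit; exact: inj_row_free. Qed.

(** The entries [d i] being non-zero, the [x i] form a basis; a non-degenerate form that is diagonal
    in a basis has no zero diagonal entry. *)
Lemma frame_nonzero m (G M : 'M[R]_m) (x : 'I_m -> 'rV[R]_m) (d d' : 'I_m -> R) :
  M \in unitmx -> (forall i, d i != 0) ->
  (forall i j, ip G (x i) (x j) = d i *+ (i == j)) ->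
  (forall i j, ip M (x i) (x j) = d' i *+ (i == j)) -> forall i, d' i != 0.
Proof.
move=> uM d0 xG xM i.
pose P := \matrix_i x i.
have PE (H : 'M[R]_m) c : (forall i j, ip H (x i) (x j) = c i *+ (i == j)) ->
    P *m H *m P^T = diag_mx (\row_i c i).
  by move=> xH; apply/matrixP => j k; rewrite -ip_row !rowK xH !mxE.
have uP : P \in unitmx.
  have : diag_mx (\row_i d i) \in unitmx.
    rewrite unitmxE det_diag unitfE; apply/prodf_neq0 => j _; rewrite mxE; exact: d0.
  by rewrite -(PE _ _ xG) unitmx_mul => /andP[_]; rewrite unitmx_tr.
have : diag_mx (\row_i d' i) \in unitmx.
  by rewrite -(PE _ _ xM) !unitmx_mul uP uM unitmx_tr uP.
rewrite unitmxE det_diag unitfE => /prodf_neq0 /(_ i isT).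
by rewrite mxE.
Qed.

Definition adjoin m (T : Type) (x : T) (E : 'I_m -> T) (i : 'I_m.+1) : T :=
  if unlift ord0 i is Some a then E a else x.

Lemma adjoin0 m T (x : T) (E : 'I_m -> T) : adjoin x E ord0 = x.
Proof. by rewrite /adjoin unlift_none. Qed.

Lemma adjoinS m T (x : T) (E : 'I_m -> T) a : adjoin x E (lift ord0 a) = E a.
Proof. by rewrite /adjoin liftK. Qed.

Lemma adjoin_orthogonal m (G : 'M[R]_m.+1) x (E : 'I_m -> 'rV[R]_m.+1) dx (d : 'I_m -> R) :
  ip G x x = dx -> (forall a, ip G (E a) x = 0) -> (forall a, ip G x (E a) = 0) ->
  (forall a c, ip G (E a) (E c) = d a *+ (a == c)) ->
  forall i j, ip G (adjoin x E i) (adjoin x E j) = adjoin dx d i *+ (i == j).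
Proof.
move=> xx Ex xE EE i j.
case: (unliftP ord0 i) => [a|] ->; case: (unliftP ord0 j) => [c|] ->;
  rewrite ?adjoin0 ?adjoinS.
- by rewrite EE (inj_eq lift_inj).
- by rewrite Ex eq_sym (negbTE (neq_lift _ _)).
- by rewrite xE (negbTE (neq_lift _ _)).
- by rewrite xx eqxx.
Qed.

Section Chart.
Variables (m : nat).
Local Notation n := m.+1.
Variables (A : set 'rV[R]_n) (G : 'rV[R]_n -> 'M[R]_n) (psi : 'rV[R]_n -> R).
Hypotheses (oA : open A) (cG : forall a c, smooth A (fun q => G q a c)).
Hypotheses (symG : forall q, A q -> (G q)^T = G q) (uG : forall q, A q -> G q \in unitmx).
Hypothesis cpsi : smooth A psi.

Lemma dpsi q : A q -> differentiable psi q.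
Proof. exact: (cpsi 1).1. Qed.

Lemma dG q : A q -> forall a c, differentiable (fun q => G q a c) q.
Proof. by move=> Aq a c; exact: (cG a c 1).1. Qed.

Lemma derivableG q v : A q -> derivable G q v.
Proof. by move=> Aq; apply/derivable_mxP => a c; apply: diff_derivable; exact: dG. Qed.

Lemma ip_sym q u v : A q -> ip (G q) u v = ip (G q) v u.
Proof. by move=> Aq; rewrite -{1}(symG Aq) ip_tr. Qed.

(** [th *m invmx (G q)] is the vector metrically dual to the covector [th]. *)
Lemma ip_raise q u th : A q -> ip (G q) u (th *m invmx (G q)) = ip 1%:M u th.
Proof. by move=> Aq; rewrite ip_sym// ip_mul1 mulmxKV ?uG// ip1C. Qed.

Definition hess (y : 'rV[R]_n) : 'M[R]_n := hess2 psi y - chr G y (dd psi y).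

(** Differentiating [dpsi(e) = 0] along [e] gives [dpsi(D_e e) = - hess2(e, e)]; the Christoffel
    terms turn both sides into covariant ones. Summed over a vertical frame, this expresses [h] by
    the Hessian. *)
Lemma hess_vertical (V : set 'rV[R]_n) (e : 'rV[R]_n -> 'rV[R]_n) y :
  open V -> V y -> V `<=` A -> smooth V e -> (forall q, V q -> 'D_(e q) psi q = 0) ->
  ip (G y) (cov G e e y) (grad G psi y) = - ip (hess y) (e y) (e y).
Proof.
move=> oV Vy VA ce ve; have Ay := VA _ Vy.
rewrite ip_raise// cov_along_ip derive_id.
have de : derivable e y (e y) by apply: diff_derivable; exact: (ce 1).1.
have [_ D1] := is_derive_along oA Ay (cpsi 2) de.
have D0 : 'D_(e y) (fun q => 'D_(e q) psi q) y = 0.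
  rewrite (@near_eq_derive _ _ _ _ (cst 0)) ?derive_cst//.
  exact: (open_near_eq oV Vy).
move: D1; rewrite D0 => /esym/eqP; rewrite addr_eq0 => /eqP D1.
by rewrite -/(dd psi y) D1 /hess ipDm ipNm opprB addrC.
Qed.

(** * The Hessian of the submersion along its gradient *)

Section Gradient.
Variables (J : set R) (te : R) (alpha : R -> R).
Hypotheses (hte : te = 1 \/ te = -1) (calpha : smooth J alpha).
Hypotheses (alpha0 : forall s, J s -> 0 < alpha s) (psiJ : forall q, A q -> J (psi q)).
Hypothesis norm_dd : forall q, A q ->
  ip 1%:M (dd psi q *m invmx (G q)) (dd psi q) = te / alpha (psi q).

Lemma sign_sqr : te * te = 1.
Proof. by case: hte => ->; rewrite ?mulr1 ?mulrNN ?mulr1. Qed.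

(* Half the derivative of |grad psi|^2 = te / alpha(psi) along grad psi. *)
Lemma hess_grad y : A y ->
  let X := dd psi y *m invmx (G y) in
  ip (hess y) X X = - ('D_1 alpha (psi y) / (2 * alpha (psi y) ^+ 3)).
Proof.
move=> Ay X.
have cG1 : Ck_mx (fun k => k = 1%N) A G by move=> k _ a c; exact: cG.
have [B [d [P [oB By BA sd [cP PGP]]]]] :=
  local_diagonalization (erefl 1%N) oA Ay cG1 symG (uG Ay).
(* The inverse Gram matrix written through the diagonalizing matrix [P], which makes its C^1
   regularity, hence that of the gradient, apparent. *)
pose Gi q := (P q)^T *m diag_mx d *m P q.
have dK : diag_mx d *m diag_mx d = 1%:M.
  rewrite mulmx_diag; apply/matrixP => i j; rewrite !mxE.
  by case: (sd i) => ->; rewrite ?mulr1 ?mulrNN ?mulr1.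
have GiE q : B q -> Gi q = invmx (G q).
  move=> Bq; have uGq := uG (BA _ Bq).
  have : P q *m (G q *m (P q)^T *m diag_mx d) = 1%:M.
    by rewrite !mulmxA PGP// dK.
  move=> /mulmx1C; rewrite -!mulmxA => GK.
  by rewrite -[RHS]mulmx1 -GK mulKmx// /Gi mulmxA.
have cGi : Ck_mx (fun k => k = 1%N) B Gi.
  apply: Ck_mx_mul => //; apply: Ck_mx_mul => //; [exact: Ck_mx_tr|exact: Ck_mx_cst].
pose gr q := dd psi q *m Gi q.
have cgr : Ck_mx (fun k => k = 1%N) B gr.
  apply: Ck_mx_mul => // k -> i j.
  apply: (@Ck_ext _ _ _ oB _ 1 (fun q => 'D_(delta_mx 0 j) psi q)) => [q _|].
    by rewrite mxE.
  by apply: (Ck_subset BA); exact: ((cpsi 2).2 (delta_mx 0 j)).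
have dgr : derivable gr y X.
  apply: diff_derivable; apply: differentiable_row => j.
  exact: (cgr 1%N erefl 0 j).1.
have grE q : B q -> gr q = dd psi q *m invmx (G q) by move=> Bq; rewrite /gr GiE.
have grX : gr y = X by rewrite grE.
have grG q : B q -> gr q *m G q = dd psi q.
  by move=> Bq; rewrite grE// mulmxKV// uG//; exact: BA.
have dGX : derivable G y X by exact: derivableG.
have dXX : derivable (fun _ : 'rV[R]_n => X) y X by exact: derivable_cst.
(* Derivative along [X] of [gr *m G = dd psi], paired with [X] frozen as a constant vector. *)
have H1 : ip (hess2 psi y) X X = ip ('D_X G y) X X + ip (G y) ('D_X gr y) X.
  have d1 : derivable (fun _ : 'rV[R]_n => 1%:M : 'M[R]_n) y X by exact: derivable_cst.
  have ddd : derivable (dd psi) y X by apply: derivable_dd (cpsi 2) Ay.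
  have [_ L] := is_derive_ip d1 ddd dXX.
  have [_ Rr] := is_derive_ip dGX dgr dXX.
  rewrite !derive_cst (derive_dd_row _ (cpsi 2) Ay) in L Rr.
  have ip0r (M : 'M[R]_n) u : ip M u 0 = 0 by rewrite /ip trmx0 mulmx0 mxE.
  have ip0m (u v : 'rV[R]_n) : ip 0 u v = 0 by rewrite /ip mulmx0 mul0mx mxE.
  rewrite !ip0r ?ip0m ?addr0 ?add0r grX in L Rr.
  rewrite ip_mul1 -L -Rr; apply: near_eq_derive.
  apply: (open_near_eq oB By) => q Bq.
  by rewrite [RHS]ip_mul1 grG.
have H2 : 'D_X (fun q => ip (G q) (gr q) (gr q)) y =
    ip ('D_X G y) X X + 2 * ip (G y) ('D_X gr y) X.
  have [_ ->] := is_derive_ip dGX dgr dgr.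
  by rewrite grX (ip_sym X)// mulr_natl mulr2n addrA.
have J0 := alpha0 (psiJ Ay).
have a0 : alpha (psi y) != 0 by rewrite gt_eqF.
have H3 : 'D_X (fun q => ip (G q) (gr q) (gr q)) y = - ('D_1 alpha (psi y) / alpha (psi y) ^+ 3).
  have -> : 'D_X (fun q => ip (G q) (gr q) (gr q)) y =
      'D_X ((fun s => te * (alpha s)^-1) \o psi) y.
    apply: near_eq_derive; apply: (open_near_eq oB By) => q Bq.
    by rewrite ip_mul1 grG// grE// ip1C norm_dd//; exact: BA.
  have da : derivable alpha (psi y) 1.
    by apply: diff_derivable; apply: (calpha 1).1; exact: psiJ.
  have dF := is_deriveM (is_derive_cst te (psi y) 1) (is_deriveV a0 (derivableP da)).
  rewrite derive_compr; [|exact: dpsi|by apply/derivable1_diffP; case: dF].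
  have [_ ->] := dF.
  rewrite derive_dd; last exact: dpsi.
  rewrite norm_dd// scaler0 addr0 /GRing.scale /=.
  move: sign_sqr; move: ('D_1 alpha (psi y)) => a1 t2.
  have -> : te * (- alpha (psi y) ^- 2 * a1) * (te / alpha (psi y)) =
     (te * te) * (- alpha (psi y) ^- 2 * a1 / alpha (psi y)) by ring.
  by rewrite t2; field.
(* The covector [dd psi] has dual vector [X] itself, so both terms of [chr_diag] involve the same
   number. *)
have H4 : ip (chr G y (dd psi y)) X X = ip ('D_X G y) X X - 2^-1 * ip ('D_X G y) X X.
  exact: (@chr_diag R _ G A y (dd psi y) X oA Ay symG (dG Ay)).
have : ip ('D_X G y) X X + 2 * ip (G y) ('D_X gr y) X = - ('D_1 alpha (psi y) / alpha (psi y) ^+ 3).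
  by rewrite -H2.
rewrite /hess ipDm ipNm H1 H4.
move: (ip ('D_X G y) X X) (ip (G y) ('D_X gr y) X) ('D_1 alpha (psi y)) => u v a1 E.
(* With [u] and [v] as named here, the Hessian is [u + v - u/2], half of the derivative [u + 2v] of
   the squared length. *)
have -> : v = (- (a1 / alpha (psi y) ^+ 3) - u) / 2 by rewrite -E; field.
by field.
Qed.

End Gradient.

(* Near a point where the j0-th partial derivative of psi does not vanish, the
   kernel of d psi is spanned by the d_j - (d_j psi / d_j0 psi) d_j0, j <> j0. *)
Lemma vertical_frame y : A y -> dd psi y != 0 ->
  (forall v, 'D_v psi y = 0 -> (forall w, 'D_w psi y = 0 -> ip (G y) v w = 0) -> v = 0) ->
  exists (B : set 'rV[R]_n) (eps : 'I_m -> R) (e : 'I_m -> 'rV[R]_n -> 'rV[R]_n),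
    [/\ open B, B y, B `<=` A, orthonormal_on B (fun q => ip (G q)) e eps
      & forall i, smooth B (e i) /\ forall q, B q -> 'D_(e i q) psi q = 0].
Proof.
move=> Ay dd0 nondeg.
have [j0 pj0] : exists j0, 'D_(delta_mx 0 j0) psi y != 0.
  have /rV0Pn[j] := dd0; rewrite mxE => ?; by exists j.
pose p j q := 'D_(delta_mx 0 j) psi q.
have cp j k : Ck k A (p j) by exact: (cpsi k.+1).2.
pose A' := A `&` (p j0) @^-1` [set x | x != 0].
have oA' : open A'.
  apply: (continuous_inP _ oA).1 => [q /[!inE] Aq|]; last exact: open_neq.
  exact: Ck_continuous (cp j0 0) Aq.
have A'A : A' `<=` A by move=> q [].
have A'0 q : A' q -> p j0 q != 0 by case.
have A'y : A' y by split.
pose X q : 'M[R]_(m, n) := \matrix_(a, j)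
  ((j == lift j0 a)%:R - (p (lift j0 a) q / p j0 q) * (j == j0)%:R).
have cX : Ck_mx (fun=> True) A' X.
  move=> k _ a j.
  apply: (@Ck_ext _ _ _ oA' _ k (fun q => (j == lift j0 a)%:R
     + -1 * (p (lift j0 a) q * (p j0 q)^-1 * (j == j0)%:R))) => [q _|].
    by rewrite mxE mulN1r.
  apply: CkD => //; first exact: Ck_cst.
  apply: CkM => //; first exact: Ck_cst.
  apply: CkM => //; last exact: Ck_cst.
  apply: CkM => //; first exact: Ck_subset A'A (cp _ _).
  by apply: CkV => //; exact: Ck_subset A'A (cp _ _).
have XE (c : 'rV[R]_m) q j : (c *m X q) 0 j =
    if unlift j0 j is Some a then c 0 a else - (\sum_a c 0 a * p (lift j0 a) q) / p j0 q.
  rewrite mxE; case: unliftP => [a|] ->.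
    rewrite (bigD1 a)//= big1 ?addr0 => [|a' a'a].
      by rewrite mxE eqxx eq_sym (negbTE (neq_lift _ _)) mulr0 subr0 mulr1.
    rewrite mxE (inj_eq lift_inj) eq_sym (negbTE a'a) eq_sym (negbTE (neq_lift _ _)).
    by rewrite mulr0 subr0 mulr0.
  rewrite mulNr mulr_suml -sumrN; apply: eq_bigr => a _.
  by rewrite mxE eqxx (negbTE (neq_lift _ _)) sub0r mulr1 mulrN mulrA.
have vX (c : 'rV[R]_m) q : A' q -> 'D_(c *m X q) psi q = 0.
  move=> A'q; have p0 := A'0 _ A'q.
  rewrite derive_dd; last by apply: dpsi; exact: A'A.
  rewrite ip1E (bigD1_ord j0)//= XE unlift_none.
  under eq_bigr => a _ do rewrite XE liftK mxE.
  by rewrite mxE -/(p j0 q) mulrVK ?unitfE// addNr.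
have XV w : 'D_w psi y = 0 -> exists c, w = c *m X y.
  rewrite derive_dd; last exact: dpsi.
  rewrite ip1E (bigD1_ord j0)//= => w0.
  exists (\row_a w 0 (lift j0 a)); apply/rowP => j; rewrite XE.
  case: unliftP => [a|] ->; first by rewrite mxE.
  under eq_bigr do rewrite mxE.
  apply: (mulIf pj0); rewrite mulrVK ?unitfE//.
  move: w0; rewrite mxE => /eqP; rewrite addr_eq0 => /eqP ->; congr (- _).
  by apply: eq_bigr => a _; rewrite mxE.
(* A row vector killed by this Gram matrix gives a vertical vector orthogonal to all vertical ones,
   which is zero by non-degeneracy of the fibre; its coordinates other than [j0] are those of the
   row vector. *)
have uXGX : X y *m G y *m (X y)^T \in unitmx.
  apply: inj_unitmx => c cXGX.
  have : c *m X y = 0.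
    apply: nondeg; first exact: vX.
    move=> w /XV[c' ->].
    by rewrite !mulmxA in cXGX; rewrite /ip trmx_mul mulmxA cXGX mul0mx mxE.
  move=> cX0; apply/rowP => a; have := XE c y (lift j0 a).
  by rewrite cX0 liftK !mxE.
have cG' : Ck_mx (fun=> True) A' G.
  by move=> k _ a c; apply: Ck_subset A'A (cG a c k).
have symG' q : A' q -> (G q)^T = G q by move=> /A'A; exact: symG.
have [B [eps [e [oB By BA' one eP]]]] :=
  orthonormal_frame (k0 := 0) I oA' A'y cG' cX symG' uXGX.
exists B, eps, e; split => //; first by move=> q /BA'/A'A.
move=> i; split=> [k|q Bq]; first exact: (eP i).1.
have /submxP[c ->] := (eP i).2 q.
by apply: vX; exact: BA'.
Qed.

End Chart.
End Submersions.

(** * The soliton equation at a point *)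

Section SolitonEquation.
Variables (R : realType).

Lemma chrZ m (G : 'rV[R]_m -> 'M[R]_m) p c th : chr G p (c *: th) = c *: chr G p th.
Proof.
apply/matrixP => a d; rewrite !mxE mulr_sumr; apply: eq_bigr => k _.
by rewrite mxE mulrCA.
Qed.

Lemma outerZ m c (u : 'rV[R]_m) : (c *: u)^T *m (c *: u) = c ^+ 2 *: (u^T *m u).
Proof. by rewrite [(c *: u)^T]linearZ /= -scalemxAl -scalemxAr scalerA expr2. Qed.

(** * Profiles with prescribed slope in the time coordinate *)

Section Profile.
Variables (U I : set R) (b rho ft : R -> R).
Hypotheses (oU : open U) (cb : smooth I b) (crho : Ck 1 U rho).
Hypotheses (ftI : forall s, U s -> I (ft s)).
Hypothesis dft : forall s, U s -> is_derive s 1 ft (b (ft s) * rho s).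

Lemma differentiable_profile s : U s -> differentiable ft s.
Proof. by move=> Us; apply/derivable1_diffP; case: (dft Us). Qed.

Lemma derive_profile v s : U s -> 'D_v ft s = v * (b (ft s) * rho s).
Proof.
move=> Us; have [_ <-] := dft Us.
rewrite !deriveE; try exact: differentiable_profile.
by rewrite -{1}[v]mulr1 -[v * 1]/(v *: (1 : R)) linearZ.
Qed.

(** Bootstrapping: [ft' = b(ft) rho] is as regular as [ft] and the C^1 function [rho] allow, so [ft]
    rises from C^0 to C^1 and then to C^2. *)
Lemma Ck2_profile : Ck 2 U ft.
Proof.
have step k : Ck k U ft -> (k <= 1)%N -> Ck k.+1 U ft.
  move=> cft k1; split=> [s|v]; first exact: differentiable_profile.
  apply: (@Ck_ext _ _ _ oU _ k (fun s => v * (b (ft s) * rho s))) => [s Us|].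
    by rewrite derive_profile.
  apply: CkM => //; first exact: Ck_cst.
  apply: CkM => //; first exact: Ck_comp oU ftI (cb k) cft.
  by case: k k1 {cft} => [|[]]// _; exact: Ck_pred.
have c0 : Ck 0 U ft.
  by move=> s Us; apply: differentiable_continuous; exact: differentiable_profile.
exact: (step 1%N (step 0%N c0 erefl) erefl).
Qed.

Lemma derive_slope s : U s -> is_derive s 1 (fun r => b (ft r) * rho r)
  ('D_1 b (ft s) * b (ft s) * rho s ^+ 2 + b (ft s) * 'D_1 rho s).
Proof.
move=> Us.
have db : is_derive (ft s) 1 b ('D_1 b (ft s)).
  by apply/derivableP/diff_derivable; apply: (cb 1).1; exact: ftI.
have dr : is_derive s 1 rho ('D_1 rho s).
  by apply/derivableP/diff_derivable; exact: crho.1.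
apply: is_derive_eq (is_deriveM (is_derive1_comp db (dft Us)) dr) _.
by rewrite /GRing.scale /=; ring.
Qed.

End Profile.

(** In the first equation, the term with the inverted factor comes from the gradient direction and
    the [b ^- 2] term from the [m] vertical directions. Both equations have proportional defects,
    with factor [b (te al - rho^2)], non-zero because the induced metric is non-degenerate. *)
Lemma soliton_scalar (m : nat) (te al al' b b' rho rho' h : R) :
  te * te = 1 -> al != 0 -> b != 0 ->
  b ^+ 2 * (te / al - rho ^+ 2 * (te / al) ^+ 2) != 0 ->
  b = (b ^+ 2 * (te / al - rho ^+ 2 * (te / al) ^+ 2))^-1 *
        ((b' * b * rho ^+ 2 + b * rho') * (te / al) ^+ 2
         + b * rho * - (al' / (2 * al ^+ 3)) + b * b' * (te / al)
         - 2 * (b' / b) * (b * rho * (te / al)) ^+ 2)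
      + b ^- 2 * (b * rho * - h + b * b' * m%:R) <->
  rho' = (te * al - rho ^+ 2) * (rho * h + b ^+ 2 - m.+1%:R * b')
         + rho * al' / (2 * al).
Proof.
move=> t2 al0 b0.
have -> : (te / al) ^+ 2 = al ^- 2 by rewrite expr_div_n [te ^+ 2]t2 div1r.
have -> : (b * rho * (te / al)) ^+ 2 = b ^+ 2 * rho ^+ 2 * al ^- 2.
  by rewrite !exprMn exprVn [te ^+ 2]t2 mul1r.
have -> : te / al - rho ^+ 2 * al ^- 2 = (te * al - rho ^+ 2) / al ^+ 2 by field.
set D := te * al - rho ^+ 2 => D0.
have {}D0 : D != 0.
  by apply: contraNneq D0 => ->; rewrite mul0r mulr0.
set lhs := (X in b = X).
have E : rho' - (D * (rho * h + b ^+ 2 - m.+1%:R * b') + rho * al' / (2 * al)) =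
    b * D * (lhs - b).
  have teE : te / al = D / al ^+ 2 + rho ^+ 2 / al ^+ 2 by rewrite /D; field.
  by rewrite /lhs teE -natr1; field; rewrite D0 b0 al0.
split=> [bE|rE].
  by apply/eqP; rewrite -subr_eq0 E -bE subrr mulr0.
move: E; rewrite rE subrr => /esym/eqP.
by rewrite !mulf_eq0 (negbTE b0) (negbTE D0) /= subr_eq0 => /eqP ->.
Qed.

(** * The soliton equation in one chart *)

Section SolitonAt.
Variables (m : nat).
Local Notation n := m.+1.
Variables (A : set 'rV[R]_n) (G : 'rV[R]_n -> 'M[R]_n) (psi : 'rV[R]_n -> R).
Hypotheses (oA : open A) (cG : forall a c, smooth A (fun q => G q a c)).
Hypotheses (symG : forall q, A q -> (G q)^T = G q) (uG : forall q, A q -> G q \in unitmx).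
Hypothesis cpsi : smooth A psi.
Variables (J : set R) (te : R) (alpha h : R -> R).
Hypotheses (hte : te = 1 \/ te = -1) (calpha : smooth J alpha).
Hypotheses (alpha0 : forall s, J s -> 0 < alpha s) (psiJ : forall q, A q -> J (psi q)).
Hypothesis norm_dd : forall q, A q ->
  ip 1%:M (dd psi q *m invmx (G q)) (dd psi q) = te / alpha (psi q).
Variables (U I : set R) (b rho ft : R -> R).
Hypotheses (oU : open U) (cb : smooth I b) (b0 : forall t, I t -> 0 < b t).
Hypotheses (crho : Ck 1 U rho) (ftI : forall s, U s -> I (ft s)).
Hypothesis dft : forall s, U s -> is_derive s 1 ft (b (ft s) * rho s).
Hypothesis psiU : forall q, A q -> U (psi q).
Variable y : 'rV[R]_n.
Hypotheses (Ay : A y) (dd0 : dd psi y != 0).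
Hypothesis nondeg : forall v, 'D_v psi y = 0 ->
  (forall w, 'D_w psi y = 0 -> ip (G y) v w = 0) -> v = 0.
Hypothesis cmc : forall (V : set 'rV[R]_n) (e : 'I_m -> 'rV[R]_n -> 'rV[R]_n) (eps : 'I_m -> R),
  open V -> V y -> V `<=` A -> (forall a, smooth V (e a)) ->
  (forall p, V p -> forall a, 'D_(e a p) psi p = 0) ->
  orthonormal_on V (fun p => ip (G p)) e eps ->
  h (psi y) = \sum_a eps a * ip (G y) (cov G (e a) (e a) y) (grad G psi y).
Hypothesis uM : G y - rho (psi y) ^+ 2 *: ((dd psi y)^T *m dd psi y) \in unitmx.

Local Notation w := (ft \o psi).

Lemma Ck2_w : Ck 2 A w.
Proof.
by apply: Ck_comp oA psiU _ (cpsi 2); exact: Ck2_profile oU cb crho ftI dft.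
Qed.

Lemma derive_w v q : A q -> 'D_v w q = b (ft (psi q)) * rho (psi q) * 'D_v psi q.
Proof.
move=> Aq; have Uq := psiU Aq; rewrite derive_compr.
- by rewrite (derive_profile dft)// mul1r.
- exact: (cpsi 1).1.
- exact: (@differentiable_profile U b rho ft dft _ Uq).
Qed.

Lemma dd_w : dd w y = (b (ft (psi y)) * rho (psi y)) *: dd psi y.
Proof. by apply/rowP => j; rewrite !mxE derive_w. Qed.

Lemma hess2_w : hess2 w y =
  ('D_1 b (ft (psi y)) * b (ft (psi y)) * rho (psi y) ^+ 2
     + b (ft (psi y)) * 'D_1 rho (psi y)) *: ((dd psi y)^T *m dd psi y)
  + (b (ft (psi y)) * rho (psi y)) *: hess2 psi y.
Proof.
have Uy := psiU Ay.
apply/matrixP => a c; rewrite !mxE big_ord1 !mxE.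
pose k r := b (ft r) * rho r.
have dk := derive_slope cb crho ftI dft Uy.
have dpsiy : differentiable psi y by exact: (cpsi 1).1.
have dkd : differentiable k (psi y) by apply/derivable1_diffP; case: dk.
rewrite (@near_eq_derive _ _ _ _ ((k \o psi) * (fun q => 'D_(delta_mx 0 c) psi q))); last first.
  by apply: (open_near_eq oA Ay) => q Aq; rewrite derive_w.
rewrite deriveM; last 2 first.
- by apply: diff_derivable; exact: differentiable_comp.
- by apply: diff_derivable; exact: ((cpsi 2).2 _).1.
rewrite derive_compr//; have [_ ->] := dk.
rewrite /GRing.scale /= /k; ring.
Qed.

(** The profile [ft] enters only through the conformal factor [b^2]; the other factor depends on
    [rho] alone, so non-degeneracy passes from the graph of [f] to all flowed graphs. *)
Lemma induced_gram_w : induced_gram b G w y =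
  b (ft (psi y)) ^+ 2 *: (G y - rho (psi y) ^+ 2 *: ((dd psi y)^T *m dd psi y)).
Proof.
by rewrite /induced_gram dd_w outerZ scalerBr scalerA exprMn.
Qed.

Lemma ip_graph_form v : ip (graph_form G b w y) v v =
  ('D_1 b (ft (psi y)) * b (ft (psi y)) * rho (psi y) ^+ 2
     + b (ft (psi y)) * 'D_1 rho (psi y)) * ip 1%:M v (dd psi y) ^+ 2
  + b (ft (psi y)) * rho (psi y) * ip (hess G psi y) v v
  + b (ft (psi y)) * 'D_1 b (ft (psi y)) * ip (G y) v v
  - 2 * ('D_1 b (ft (psi y)) / b (ft (psi y))) *
      (b (ft (psi y)) * rho (psi y) * ip 1%:M v (dd psi y)) ^+ 2.
Proof.
rewrite /graph_form hess2_w dd_w chrZ outerZ /hess [in RHS]ipDm [in RHS]ipNm.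
rewrite 4!ipDm 2!ipNm 6!ipZm ip_outer /=.
by ring.
Qed.

(** The gradient and an orthonormal vertical frame form a basis orthogonal for [G] and for the
    induced metric at once, since [dw] is a multiple of [dpsi] and vanishes on vertical vectors. The
    trace of [graph_form] is computed in it. *)
Lemma soliton_at :
  is_mean_curvature (warp b G) A (graph_map w) y
    (b (w y) *: (partial_t R n *m normal_at (warp b G) (graph_map w) y)) <->
  'D_1 rho (psi y) =
    (te * alpha (psi y) - rho (psi y) ^+ 2) *
      (rho (psi y) * h (psi y) + b (ft (psi y)) ^+ 2 - n%:R * 'D_1 b (ft (psi y)))
    + rho (psi y) * 'D_1 alpha (psi y) / (2 * alpha (psi y)).
Proof.
have Uy := psiU Ay; have Iy := ftI Uy.
have by0 : b (ft (psi y)) != 0 by rewrite gt_eqF// b0.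
have al0 : alpha (psi y) != 0 by rewrite gt_eqF// alpha0//; exact: psiJ.
have uga : induced_gram b G w y \in unitmx.
  by rewrite induced_gram_w unitmxZ// unitfE expf_neq0.
have gse := @graph_soliton_eq R n A G I b w oA symG (fun a c => cG a c 1) (cb 1)
  (fun q Aq => ftI (psiU Aq)) Ck2_w y Ay by0 (uG Ay) uga.
have [B [eps [e [oB By BA one eP]]]] := vertical_frame oA cG symG cpsi Ay dd0 nondeg.
have hE : \sum_a eps a * ip (hess G psi y) (e a y) (e a y) = - h (psi y).
  rewrite (cmc oB By BA (fun a => (eP a).1) (fun p Bp a => (eP a).2 p Bp) one).
  rewrite -sumrN; apply: eq_bigr => a _.
  rewrite (hess_vertical oA symG uG cpsi oB By BA (eP a).1 (eP a).2).
  by rewrite mulrN opprK.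
have dpsiy : differentiable psi y by exact: (cpsi 1).1.
have eT a : ip 1%:M (e a y) (dd psi y) = 0.
  by rewrite -derive_dd//; exact: (eP a).2.
pose X := dd psi y *m invmx (G y).
pose N := te / alpha (psi y).
have XT : ip 1%:M X (dd psi y) = N by rewrite norm_dd.
have raise u : ip (G y) u X = ip 1%:M u (dd psi y).
  exact: (ip_raise symG uG).
have GXX : ip (G y) X X = N by rewrite raise.
have GEX a : ip (G y) (e a y) X = 0 by rewrite raise.
have GXE a : ip (G y) X (e a y) = 0 by rewrite (ip_sym symG)// GEX.
have GEE a c : ip (G y) (e a y) (e c y) = eps a *+ (a == c) by exact: one.2.
have MXX u v : ip (induced_gram b G w y) u v = b (ft (psi y)) ^+ 2 *
    (ip (G y) u v - rho (psi y) ^+ 2 * (ip 1%:M u (dd psi y) * ip 1%:M v (dd psi y))).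
  by rewrite induced_gram_w ipZm ipDm ipNm ipZm ip_outer.
set bb := b (ft (psi y)) in by0 MXX *.
set r := rho (psi y) in MXX *.
(* The squared length of the gradient [X] for the induced metric. *)
pose dX := bb ^+ 2 * (N - r ^+ 2 * N ^+ 2).
have N0 : N != 0 by rewrite mulf_neq0 ?invr_eq0//; case: hte => ->; rewrite ?oppr_eq0 oner_eq0.
have eps0 a : eps a != 0 by case: (one.1 a) => ->; rewrite ?oppr_eq0 oner_eq0.
have oG := adjoin_orthogonal GXX GEX GXE GEE.
have oM := @adjoin_orthogonal R m (induced_gram b G w y) X (fun a => e a y) dX
  (fun a => bb ^+ 2 * eps a).
have {}oM : forall i j, ip (induced_gram b G w y) (adjoin X (fun a => e a y) i)
    (adjoin X (fun a => e a y) j) = adjoin dX (fun a => bb ^+ 2 * eps a) i *+ (i == j).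
  apply: oM => [|a|a|a c]; rewrite MXX.
  - by rewrite GXX XT expr2.
  - by rewrite GEX eT mul0r mulr0 subr0 mulr0.
  - by rewrite GXE eT !mulr0 subr0 mulr0.
  - by rewrite GEE eT mul0r mulr0 subr0 mulrnAr.
have d0 i : adjoin N eps i != 0.
  by case: (unliftP ord0 i) => [a|] ->; rewrite ?adjoinS ?adjoin0.
have dM0 := frame_nonzero uga d0 oG oM.
have dX0 : dX != 0 by have := dM0 ord0; rewrite adjoin0.
have tr := trace_frame (graph_form G b w y) dM0 oM.
rewrite big_ord_recl !adjoin0 in tr.
have hX := hess_grad oA cG symG uG cpsi hte calpha alpha0 psiJ norm_dd Ay.
(* Vertical contribution: the Hessian terms add up to [- h], the terms [b b' g] to [m], and those in
   [dpsi] vanish. *)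
have sumE : \sum_(i < m) (adjoin dX (fun a => bb ^+ 2 * eps a) (lift ord0 i))^-1 *
      ip (graph_form G b w y) (adjoin X (fun a => e a y) (lift ord0 i))
        (adjoin X (fun a => e a y) (lift ord0 i)) =
    bb ^- 2 * (bb * r * - h (psi y) + bb * 'D_1 b (ft (psi y)) * m%:R).
  have -> : m%:R = \sum_(i < m) (1 : R) by rewrite sumr_const card_ord.
  rewrite -hE !mulr_sumr -big_split mulr_sumr; apply: eq_bigr => a _ /=.
  rewrite !adjoinS ip_graph_form eT GEE eqxx mulr1n.
  rewrite -/bb -/r; have ee : eps a * eps a = 1.
    by case: (one.1 a) => ->; rewrite ?mulr1 ?mulrNN ?mulr1.
  rewrite invfM (_ : (eps a)^-1 = eps a); last first.
    by apply: (mulIf (eps0 a)); rewrite mulVf// ee.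
  move: ('D_1 b (ft (psi y))) ('D_1 rho (psi y)) (ip _ (e a y) (e a y)) => b1 r1 hs.
  by rewrite -[in RHS]ee; ring.
rewrite sumE ip_graph_form XT GXX hX -/bb -/r in tr.
apply: (iff_trans gse); rewrite -tr.
by apply: soliton_scalar => //; exact: sign_sqr.
Qed.

End SolitonAt.
End SolitonEquation.

(** * The soliton equation on the manifold *)

Section Manifold.
Variables (R : realType) (n : nat) (N : manifold R n) (g : metric N).
Variables (phi : N -> R) (J : set R) (te : R) (alpha : R -> R).
Hypothesis hphi : pr_submersion g J te alpha phi.

Lemma cimg_mem (i : chart N) (S : set N) y :
  cimg i S y -> exists x, [/\ cdom i x, S x, Defs.coord i x = y & local phi i y = phi x].
Proof.
by move=> [x [ix Sx] <-]; exists x; split; rewrite // /local /= coordK.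
Qed.

Lemma cimgT_open (i : chart N) : open (cimg i [set: N]).
Proof. by rewrite /cimg setIT; exact: cimg_open. Qed.

Lemma cimg_preimage (i : chart N) (U : set R) :
  cimg i (phi @^-1` U) = cimg i [set: N] `&` (local phi i @^-1` U).
Proof.
apply/seteqP; split=> y.
  by move=> /[dup] /cimg_mem[x [ix Ux <- E]] _; split; [exists x|rewrite /preimage/= E].
move=> [/cimg_mem[x [ix _ <- E]]]; rewrite /preimage/= E => Ux.
by exists x.
Qed.

Lemma cimg_preimage_open (i : chart N) (U : set R) :
  open U -> open (cimg i (phi @^-1` U)).
Proof.
case: hphi => _ cphi _ _ _ oU; rewrite cimg_preimage.
apply: (continuous_inP _ (@cimgT_open i)).1 => // y /[!inE] iy.
exact: Ck_continuous (cphi i 0%N) iy.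
Qed.

Lemma gram_unit (i : chart N) y : cimg i [set: N] y -> g i y \in unitmx.
Proof.
move=> iy; have [q idx] := gram_index g; have [_ [P uP E]] := idx i y iy.
have : diag_mx (\row_(k < n) (-1) ^+ (k < q)%N) \in @unitmx R n.
  rewrite unitmxE det_diag unitfE; apply/prodf_neq0 => k _.
  by rewrite mxE expf_neq0// oppr_eq0 oner_eq0.
by rewrite -E !unitmx_mul => /andP[/andP[]].
Qed.

Lemma dphi (i : chart N) y : cimg i [set: N] y -> differentiable (local phi i) y.
Proof. by case: hphi => _ cphi _ _ _; exact: (cphi i 1%N).1. Qed.

Lemma dd_neq0 (i : chart N) y : cimg i [set: N] y -> dd (local phi i) y != 0.
Proof.
move=> iy; case: hphi => _ _ /(_ i y iy)[v v0] _ _.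
apply: contraNneq v0 => d0; rewrite (derive_dd _ (dphi iy)) d0.
by rewrite /ip trmx0 mulmx0 mxE.
Qed.

(** The gradient is horizontal, so its squared length [M] satisfies [M = te alpha M^2]. If [M] were
    0 the gradient would also be vertical, hence zero, which a submersion excludes. *)
Lemma norm_grad (i : chart N) y : te = 1 \/ te = -1 -> 0 < alpha (local phi i y) ->
  cimg i [set: N] y ->
  ip 1%:M (dd (local phi i) y *m invmx (g i y)) (dd (local phi i) y)
    = te / alpha (local phi i y).
Proof.
move=> hte a0 iy; case: hphi => _ _ _ nondeg len.
set T := dd _ _; set X := T *m invmx _; set a := alpha _ in a0 *.
have uG := gram_unit iy.
have DX w : 'D_w (local phi i) y = ip 1%:M w T by rewrite (derive_dd _ (dphi iy)).
have GX w : ip (g i y) X w = ip 1%:M w T by rewrite ip_mul1 mulmxKV// ip1C.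
have horX : horizontal g phi i y X by move=> w; rewrite /vertical DX GX.
have := len i y iy X horX; rewrite GX DX -/a.
set M := ip _ X T => E.
have M0 : M != 0.
  apply/eqP => M0; have X0 : X = 0 by apply: (nondeg i y iy) => //; rewrite /vertical DX.
  by have := dd_neq0 iy; rewrite -/T -[T](mulmxKV uG) -/X X0 mul0mx eqxx.
have {}E : te * a * M = 1 by apply: (mulIf M0); rewrite mul1r [RHS]E expr2 mulrA.
have a1 : a != 0 by rewrite gt_eqF.
apply: (mulfI (mulf_neq0 (_ : te != 0) a1)).
  by case: hte => ->; rewrite ?oppr_eq0 oner_eq0.
by rewrite E -[LHS](sign_sqr hte); field.
Qed.

End Manifold.

(** * The differential equation in terms of the slope *)

Section Ode.
Variables (R : realType) (n : nat) (te : R) (alpha h b : R -> R) (J I U : set R) (f : R -> R).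
Hypotheses (calpha : smooth J alpha) (alpha0 : forall s, J s -> 0 < alpha s).
Hypotheses (cb : smooth I b) (b0 : forall t, I t -> 0 < b t).
Hypotheses (oU : open U) (UJ : U `<=` J) (cf : Ck 2 U f) (fI : forall s, U s -> I (f s)).

(* The derivative of f in the time coordinate \int dt / b, which is invariant
   under the flow. *)
Definition slope (s : R) : R := 'D_1 f s / b (f s).

Lemma bf_neq0 s : U s -> b (f s) != 0.
Proof. by move=> Us; rewrite gt_eqF// b0//; exact: fI. Qed.

Lemma is_derive_slope s : U s -> is_derive s 1 f (b (f s) * slope s).
Proof.
move=> Us; rewrite /slope mulrC mulfVK ?bf_neq0//.
by apply/derivableP/diff_derivable; exact: cf.1.
Qed.

Lemma Ck1_slope : Ck 1 U slope.
Proof.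
apply: CkM => //; first exact: (cf.2 1).
apply: CkV => //; first exact: bf_neq0.
by apply: Ck_comp oU fI (cb 1) _; exact: Ck_pred.
Qed.

(** Write [r] for the slope, so that [f' = b r] and [f'' = b' b r^2 + b r']. The logarithmic
    derivative [alpha'/alpha + 2 b' r] absorbs the term [b' b r^2], and the two equations differ by
    the non-zero factor [b(f)]. *)
Lemma soliton_ode_slope (ft : R -> R) :
  soliton_ode n te alpha h b U f ft <->
  forall s, U s -> 'D_1 slope s =
    (te * alpha s - slope s ^+ 2) *
      (slope s * h s + b (ft s) ^+ 2 - n%:R * 'D_1 b (ft s))
    + slope s * 'D_1 alpha s / (2 * alpha s).
Proof.
have key s : U s ->
  (derive1n 2 f s =
      (te * alpha s - derive1 f s ^+ 2 / b (f s) ^+ 2) *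
        (h s * derive1 f s + b (f s) * (b (ft s) ^+ 2 - n%:R * derive1 b (ft s)))
      + derive1 f s / 2 * derive1 (fun r => ln (alpha r * b (f r) ^+ 2)) s) <->
  'D_1 slope s =
    (te * alpha s - slope s ^+ 2) *
      (slope s * h s + b (ft s) ^+ 2 - n%:R * 'D_1 b (ft s))
    + slope s * 'D_1 alpha s / (2 * alpha s).
  move=> Us; have Js := UJ Us; have bf0 := bf_neq0 Us.
  have a0 : alpha s != 0 by rewrite gt_eqF// alpha0.
  have Df r : U r -> derive1 f r = b (f r) * slope r.
    by move=> Ur; rewrite derive1E; case: (is_derive_slope Ur).
  have D2f : derive1n 2 f s =
      'D_1 b (f s) * b (f s) * slope s ^+ 2 + b (f s) * 'D_1 slope s.
    rewrite derive1nS derive1n1 derive1E.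
    rewrite (near_eq_derive _ (open_near_eq oU Us Df)).
    by have [_ ->] := derive_slope cb Ck1_slope fI is_derive_slope Us.
  have Dln : derive1 (fun r => ln (alpha r * b (f r) ^+ 2)) s =
      'D_1 alpha s / alpha s + 2 * 'D_1 b (f s) * slope s.
    have da : is_derive s 1 alpha ('D_1 alpha s).
      by apply/derivableP/diff_derivable; exact: (calpha 1).1.
    have db : is_derive (f s) 1 b ('D_1 b (f s)).
      by apply/derivableP/diff_derivable; apply: (cb 1).1; exact: fI.
    have dbf := is_derive1_comp db (is_derive_slope Us).
    have dp := is_deriveM (is_deriveM da dbf) dbf.
    have p0 : 0 < (alpha * (b \o f) * (b \o f)) s.
      by rewrite /GRing.mul /= !mulr_gt0// ?alpha0// b0//; exact: fI.
    have -> : (fun r => ln (alpha r * b (f r) ^+ 2)) = @ln R \o (alpha * (b \o f) * (b \o f)).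
      by apply/funext => r /=; rewrite expr2 mulrA.
    rewrite derive1E; have [_ ->] := is_derive1_comp (is_derive1_ln p0) dp.
    change ((alpha s * b (f s) * b (f s))^-1 *
      ((alpha s * b (f s)) * ('D_1 b (f s) * (b (f s) * slope s)) +
        b (f s) * (alpha s * ('D_1 b (f s) * (b (f s) * slope s)) + b (f s) * 'D_1 alpha s)) =
      'D_1 alpha s / alpha s + 2 * 'D_1 b (f s) * slope s).
    by field; rewrite bf0 a0.
  rewrite D2f Dln (Df _ Us) derive1E.
  move: ('D_1 b (f s)) ('D_1 slope s) ('D_1 alpha s) ('D_1 b (ft s)) (slope s) (b (ft s))
    => b1 r1 a1 bt1 r bt.
  set l := (X in X = _ <-> _); set rr := (X in _ = X <-> _); set r' := (X in _ <-> _ = X).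
  have E : l - rr = b (f s) * (r1 - r').
    by rewrite /l /rr /r'; field; rewrite a0 bf0.
  split=> /eqP; rewrite -subr_eq0 => /eqP H; apply/eqP; rewrite -subr_eq0.
    by move: E; rewrite H => /esym/eqP; rewrite mulf_eq0 (negbTE bf0).
  by rewrite E H mulr0.
by split=> H s Us; apply/key => //; exact: H.
Qed.

End Ode.

(** The equivalence at one time. The profile [ft] is known only by its slope [ft' / b(ft)], equal to
    that of [f], which covers every time of the flow as well as [ft = f]. *)
Lemma soliton_eq_ode (R : realType) (n : nat) (N : manifold R n)
    (g : metric N) (J : set R) (te : R) (alpha : R -> R) (phi : N -> R) (h : R -> R)
    (I : set R) (b : R -> R) (U : set R) (f ft : R -> R)
    (hte : te = 1 \/ te = -1)
    (halpha : smooth J alpha) (halpha0 : forall s, J s -> 0 < alpha s)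
    (hphi : pr_submersion g J te alpha phi) (hcmc : fibres_cmc g phi h)
    (hb : smooth I b) (hb0 : forall t, I t -> 0 < b t)
    (hU : open U) (hUJ : U `<=` J)
    (hf : Ck 2 U f) (hfI : forall s, U s -> I (f s))
    (hnd : graph_nondegenerate g b (phi @^-1` U) (f \o phi))
    (hftI : forall s, U s -> I (ft s))
    (hft : forall s, U s -> is_derive s 1 ft (b (ft s) * slope b f s)) :
  soliton_eq g b (phi @^-1` U) (ft \o phi) <-> soliton_ode n te alpha h b U f ft.
Proof.
rewrite (soliton_ode_slope n te h halpha halpha0 hb hb0 hU hUJ hf hfI ft).
have [rphi cphi dphi0 nondeg len] := hphi.
case: n N g phi hphi hcmc hnd rphi cphi dphi0 nondeg len => [|m] N g phi hphi hcmc hnd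
    rphi cphi dphi0 nondeg len.
  (* In dimension 0 there is no non-zero differential, so [N] is empty, then so is [J], the range of
     [phi], and both sides hold vacuously. *)
  have noN (x : N) : False.
    have [i ix] := chart_cover x.
    have [|v] := dphi0 i (Defs.coord i x); first by exists x.
    by rewrite [v]thinmx0 derive0 eqxx.
  split=> [_ s /hUJ|_ i y [x _ _]]; last by have := noN x.
  by rewrite -rphi => -[x]; have := noN x.
have key i y : cimg i (phi @^-1` U) y ->
  is_mean_curvature (warped g b i) (cimg i (phi @^-1` U)) (graph (ft \o phi) i) y
      (b (local (ft \o phi) i y) *:
        (partial_t R m.+1 *m normal_at (warped g b i) (graph (ft \o phi) i) y)) <->
  'D_1 (slope b f) (local phi i y) =
    (te * alpha (local phi i y) - slope b f (local phi i y) ^+ 2) *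
      (slope b f (local phi i y) * h (local phi i y) + b (ft (local phi i y)) ^+ 2
        - m.+1%:R * 'D_1 b (ft (local phi i y)))
    + slope b f (local phi i y) * 'D_1 alpha (local phi i y) / (2 * alpha (local phi i y)).
  move=> iUy; set D := cimg i (phi @^-1` U).
  have DT : D `<=` cimg i [set: N] by rewrite /D cimg_preimage => z [].
  have DU q : D q -> U (local phi i q) by rewrite /D cimg_preimage => -[].
  have DJ q : D q -> J (local phi i q) by move=> /DU/hUJ.
  have oD : open D by exact: cimg_preimage_open hphi _ _ hU.
  have cG a c : smooth D (fun q => g i q a c).
    by move=> k; apply: (Ck_subset DT); exact: gram_smooth.
  have symG q : D q -> (g i q)^T = g i q by move=> /DT; exact: gram_sym.
  have uG q : D q -> g i q \in unitmx by move=> /DT; exact: gram_unit.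
  have cpsi : smooth D (local phi i) by move=> k; apply: (Ck_subset DT); exact: cphi.
  have nrm q : D q -> ip 1%:M (dd (local phi i) q *m invmx (g i q)) (dd (local phi i) q) =
      te / alpha (local phi i q).
    move=> Dq; apply: (norm_grad hphi hte _ (DT _ Dq)).
    by apply: halpha0; exact: DJ.
  have cmc (V : set 'rV[R]_m.+1) (e : 'I_m -> 'rV[R]_m.+1 -> 'rV[R]_m.+1) (eps : 'I_m -> R) :
      open V -> V y -> V `<=` D -> (forall a, smooth V (e a)) ->
      (forall p, V p -> forall a, 'D_(e a p) (local phi i) p = 0) ->
      orthonormal_on V (fun p => ip (g i p)) e eps ->
      h (local phi i y) =
      \sum_a eps a * ip (g i y) (cov (g i) (e a) (e a) y) (grad (g i) (local phi i) y).
    move=> oV Vy VD ce ve one; apply: (hcmc i V y e eps oV Vy _ ce ve one).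
    by move=> z /VD/DT.
  have crho := Ck1_slope hb hb0 hU hf hfI.
  have uM : g i y - slope b f (local phi i y) ^+ 2 *:
      ((dd (local phi i) y)^T *m dd (local phi i) y) \in unitmx.
    (* The hypothesis concerns the graph of [f], whose induced Gram matrix is this matrix up to a
       factor [b(f)^2]. *)
    apply: inj_unitmx => c cM; apply: (hnd i y iUy) => z.
    have dw : differentiable (f \o local phi i) y.
      apply: differentiable_comp; first exact: (cpsi 1%N).1.
      exact: hf.1 _ (DU _ iUy).
    apply: etrans (induced_formE b (g i) c z dw) _.
    rewrite (induced_gram_w (g i) cpsi (is_derive_slope hb0 hf hfI) DU iUy).
    by rewrite ipZm ip_mul1 cM /ip !mul0mx mxE mulr0.
  exact: (soliton_at oD cG symG uG cpsi hte halpha halpha0 DJ nrm hU hb hb0 crho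
    hftI hft DU iUy (dd_neq0 hphi (DT _ iUy)) (nondeg i y (DT _ iUy)) cmc uM).
split=> [H s Us|H i y iy].
  (* Surjectivity of [phi] and the covering by charts turn each [s] in [U] into a point where the
     chart equation can be read. *)
  have [x _ xs] : range phi s by rewrite rphi; exact: hUJ.
  have [i ix] := chart_cover x.
  have iy : cimg i (phi @^-1` U) (Defs.coord i x).
    by exists x => //; split => //; rewrite /preimage /= xs.
  have := (key i _ iy).1 (H i _ iy).
  by rewrite /local /= coordK// xs.
apply/key => //; apply: H.
by move: iy; rewrite cimg_preimage => -[].
Qed.

Unset Implicit Arguments.

Theorem proposition3p13 (R : realType) (n : nat) (N : manifold R n)
  (g : metric N)
  (J : set R) (te : R) (alpha : R -> R) (phi : N -> R) (h : R -> R)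
  (I : set R) (b : R -> R) (U : set R) (f : R -> R) (A : R -> R -> R)
  (hJ : open_interval J) (hte : te = 1 \/ te = -1)
  (halpha : smooth J alpha) (halpha0 : forall s, J s -> 0 < alpha s)
  (hphi : pr_submersion g J te alpha phi)
  (hh : smooth J h) (hcmc : fibres_cmc g phi h)
  (hI : open_interval I)
  (hb : smooth I b) (hb0 : forall t, I t -> 0 < b t)
  (hU : open U) (hUJ : U `<=` J)
  (hf : Ck 2 U f) (hfI : forall s, U s -> I (f s))
  (hnd : graph_nondegenerate g b (phi @^-1` U) (f \o phi))
  (hA0 : forall s, I s -> A s 0 = s) :
  (forall epsilon : R, 0 < epsilon -> is_flow b I (f @` U) epsilon A ->
     (X_soliton g b phi U f A epsilon <->
      forall t, `|t| < epsilon ->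
        soliton_ode n te alpha h b U f (flowed A f t))) /\
  (pointwise_X_soliton g b phi U f A <->
   soliton_ode n te alpha h b U f (flowed A f 0)).
Proof.
have iff ft := @soliton_eq_ode R n N g J te alpha phi h I b U f ft hte halpha halpha0
  hphi hcmc hb hb0 hU hUJ hf hfI hnd.
have df s : U s -> is_derive s 1 f ('D_1 f s).
  by move=> Us; apply/derivableP/diff_derivable; exact: hf.1.
have fUI : f @` U `<=` I by move=> _ [s Us <-]; exact: hfI.
split.
  move=> epsilon e0 flow.
  have sol t : `|t| < epsilon -> soliton_eq g b (phi @^-1` U) (flowed A f t \o phi) <->
      soliton_ode n te alpha h b U f (flowed A f t).
    move=> te'; apply: iff => [s Us|s Us].
      by apply: (flow (f s) _ t te').1; exists s.
    exact: (flow_derive hI hb hb0 hA0 flow hU (fun=> id) fUI Us te' (df s Us)).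
  by split=> H t te'; apply/sol => //; exact: H.
(* The pointwise statement comes from the initial condition [A s 0 = s], by which the profile at
   time 0 is [f] on [U]. *)
have A0 s : U s -> f s = flowed A f 0 s by move=> Us; rewrite /flowed hA0//; exact: hfI.
apply: iff => s Us; first by rewrite -A0//; exact: hfI.
rewrite -(A0 s Us); apply: (near_eq_is_derive (open_near_eq hU Us A0)).
exact: is_derive_slope hb0 hf hfI s Us.
Qed.
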